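(* Let $\sigma\in(0,1/2)$ and $d=1$. Assume that $u$ is an $\mathcal{H}^\sigma$-harmonic function of a positive fractional Schrödinger operator $\mathcal{H}^\sigma=\Delta^\sigma+V$ on $\mathbb{Z}$ with $V\le1$. If $$u\in O\big(|x|^{(2\sigma-d)/2}\big)=O\big(|x|^{(2\sigma-1)/2}\big)\qquad\text{and}\qquad\liminf_{x\to\infty}|u(x)|\,|x|^{1+2\sigma}=0,$$ then $u=0$.
   Context: $L$ is the bounded positive selfadjoint operator on $\ell^2(\mathbb{Z})$ given by $Lf(x)=2f(x)-f(x-1)-f(x+1)$, with heat semigroup $\mathrm{e}^{-tL}$. For $\sigma\in(0,1)$ let $$b_\sigma(x,y)=\frac1{|\Gamma(-\sigma)|}\int_0^\infty(\mathrm{e}^{-tL}1_y)(x)\,\frac{\mathrm{d}t}{t^{1+\sigma}}\quad(x\neq y),\qquad b_\sigma(x,x)=0,$$ where $1_y$ is the characteristic function of $\{y\}$; $b_\sigma$ is a symmetric weight with $\sum_yb_\sigma(x,y)<\infty$. Let $\mathcal{F}_{b_\sigma}=\{f:\mathbb{Z}\to\mathbb{R}\mid\sum_yb_\sigma(x,y)|f(y)|<\infty\text{ for all }x\}$. The fractional Laplacian is $\Delta^\sigma f(x)=\sum_{y\in\mathbb{Z}}b_\sigma(x,y)(f(x)-f(y))$ for $f\in\mathcal{F}_{b_\sigma}$; it extends the spectrally defined operator $L^\sigma$ on $\ell^2(\mathbb{Z})$. For a potential $V:\mathbb{Z}\to\mathbb{R}$, $\mathcal{H}^\sigma f=\Delta^\sigma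 f+Vf$, $f\in\mathcal{F}_{b_\sigma}$. A function $u$ is $\mathcal{H}^\sigma$-harmonic if $u\in\mathcal{F}_{b_\sigma}$ and $\mathcal{H}^\sigma u=0$ on $\mathbb{Z}$. $\mathcal{H}^\sigma$ is positive if there exists a nontrivial $w\in\mathcal{F}_{b_\sigma}$, $w\ge0$, with $\mathcal{H}^\sigma w\ge0$; equivalently, $\frac12\sum_{x,y}b_\sigma(x,y)(\varphi(x)-\varphi(y))^2+\sum_xV(x)\varphi(x)^2\ge0$ for all finitely supported $\varphi$. The limit $x\to\infty$ means that $x$ leaves every finite subset of $\mathbb{Z}$ (i.e. $|x|\to\infty$, one-point compactification), and $f\in O(g)$ means $\limsup_{x\to\infty}|f(x)|/|g(x)|<\infty$. *)

(* Defs.v *)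
From HB Require Import structures.
From mathcomp Require Import all_boot all_order all_algebra.
From mathcomp Require Import all_classical all_reals all_analysis.

Set Implicit Arguments.
Unset Strict Implicit.
Unset Printing Implicit Defensive.

Import Order.TTheory GRing.Theory Num.Theory.
Import numFieldNormedType.Exports.

Local Open Scope classical_set_scope.
Local Open Scope ring_scope.

                                                                
Definition eulerGamma (R : realType) (s : R) : R :=
  \int[lebesgue_measure]_(t in `]0, +oo[) (t `^ (s - 1) * expR (- t)).

                                                                         
                                                                             
                                                                               
Definition Gamma (R : realType) (s : R) : R :=
  if 0 < s then eulerGamma s
  else let n := `|Num.floor s|%N in
       eulerGamma (s + n%:R) / \prod_(k < n) (s + k%:R).

Definition lapl (R : realType) (f : int -> R) : int -> R :=
  fun x => 2 * f x - f (x - 1) - f (x + 1).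

                                                                              
                                                                          
Definition heat (R : realType) (t : R) (f : int -> R) (x : int) : R :=
  limn (series (fun n => exp_coeff (- t) n * iter n (@lapl R) f x)).

Definition bsigma (R : realType) (sigma : R) (x y : int) : R :=
  if x == y then 0
  else `|Gamma (- sigma)|^-1 *
       \int[lebesgue_measure]_(t in `]0, +oo[)
         (heat t (\1_[set y]) x / t `^ (1 + sigma)).

Definition Fsigma (R : realType) (sigma : R) : set (int -> R) :=
  [set f | forall x,
     (\esum_(y in [set: int]) (bsigma sigma x y * `|f y|)%:E < +oo)%E].

                                                                             
                                      
Definition sumZ (R : realType) (f : int -> R) : R :=
  fine (\esum_(y in [set: int]) (EFin \o f)^\+ y
        - \esum_(y in [set: int]) (EFin \o f)^\- y)%E.

Definition fracLaplacian (R : realType) (sigma : R) (f : int -> R) (x : int) : R :=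
  sumZ (fun y => bsigma sigma x y * (f x - f y)).

Definition schrodinger (R : realType) (sigma : R) (V f : int -> R) (x : int) : R :=
  fracLaplacian sigma f x + V x * f x.

Definition schrodinger_harmonic (R : realType) (sigma : R) (V u : int -> R) : Prop :=
  Fsigma sigma u /\ forall x, schrodinger sigma V u x = 0.

Definition positive_schrodinger (R : realType) (sigma : R) (V : int -> R) : Prop :=
  exists w : int -> R,
    [/\ Fsigma sigma w, exists x, w x != 0, forall x, 0 <= w x
      & forall x, 0 <= schrodinger sigma V w x].

                                                                                 
                                                                                    
Definition limsupZ (R : realType) (f : int -> R) : \bar R :=
  ereal_inf [set ereal_sup ((EFin \o f) @` A) | A in @frechet_filter int].

Definition liminfZ (R : realType) (f : int -> R) : \bar R :=
  ereal_sup [set ereal_inf ((EFin \o f) @` A) | A in @frechet_filter int].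

Definition bigO_Z (R : realType) (f g : int -> R) : Prop :=
  (limsupZ (fun x => (`|f x| / `|g x|)%R) < +oo)%E.

Definition absZ (R : realType) (x : int) : R := `|x%:~R|.

(* Main.v *)
Require Import Defs.
From mathcomp Require Import all_boot all_order all_algebra.
From mathcomp Require Import all_classical all_reals all_analysis measurable_realfun.
From mathcomp Require Import ring lra zify.
Import Order.TTheory GRing.Theory Num.Theory.
Import numFieldNormedType.Exports.
Local Open Scope classical_set_scope.
Local Open Scope ring_scope.
Set Implicit Arguments.
Unset Strict Implicit.
Unset Printing Implicit Defensive.

(** The proof compares two ground states. Positivity of the operator provides
    a strictly positive supersolution [w] (minimum principle:
    [supersolution_gt0], since the kernel [b x y] charges all pairs [x != y]).
    Put [f = u phi] with [phi] finitely supported. Completing squares in the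
    quadratic form [Q f] of the operator with respect to [w], and with respect
    to the harmonic function [u], gives
      [sum b x y w x w y (f x / w x - f y / w y)^2 <= 2 Q f
         = sum b x y u x u y (phi x - phi y)^2]
    ([energy_comparison]). So if some [phi n] tends to [1] pointwise while the
    right-hand side tends to [0], the ratio [u / w] is constant.

    Such [phi n] exist because of the growth bound on [u]. With
    [N x = 1 + |x|], [al = (1 - 2 sigma) / 2], [|u| <= C N^-al] and
    [b x y <= C |x - y|^-(1 + 2 sigma)], the logarithmic cutoff
    [phi n x = max 0 (1 - ln (N x) / ln n)] has energy [O (1 / ln n)]: the
    kernel [|x - y|^-(1 + 2 sigma) (N x N y)^-al] is homogeneous of degree
    [-2], so that after summing over [y] each [x] with [N x < n] contributes
    [1 / (N x ln n ^ 2)], and [sum 1 / N x] is of order [ln n]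
    ([cutoff_energy_le]).

    Hence [u = k w]. On the other hand [w] is a supersolution and [V <= 1], so
    one jump to the origin gives [b x 0 w 0 <= (degree x + 1) w x], whence
    [w x >= d |x|^-(1 + 2 sigma)] with [d > 0]
    ([supersolution_lower_bound]). The assumption on the lower limit then
    forces [k = 0].

    What remains is the two-sided estimate of [b] ([bsigma_bounds]). Splitting
    [L = 2 - A], with [A] the sum over the two neighbours, the heat kernel at
    distance [n] is [exp (-2 t)] times the series of
    [t^(n + 2 k) / (k! (n + k)!)], all of whose terms are positive
    ([heat_indicE]). Integrating termwise expresses [b] through a series
    [kernel n] of Gamma-type integrals, and a telescoping identity between the
    partial sums yields
    [(n + 1 + sigma) kernel n.+1 = (n - sigma) kernel n] ([kernel_rec]).
    Bernoulli's inequality turns this recurrence into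
    [kernel n] being comparable to [n^-(1 + 2 sigma)] ([kernel_bounds]). *)

(** * Gamma-type integrals *)

Section Mellin.
Context {R : realType}.
Implicit Types (c s t : R).
Notation mu := (@lebesgue_measure R).

(** For [c > 0] and [s > 0] this is [Gamma s / c^s]; the extended real value avoids any
    integrability side condition. *)
Definition mellin_exp c s : \bar R :=
  (\int[mu]_(t in `]0%R, +oo[) (t `^ (s - 1) * expR (- (c * t)))%:E)%E.

(** Compact slabs exhausting the half-line, away from the singularity that
    [t^(s - 1)] has at the origin when [s < 1]. *)
Let slab (j : nat) : set R := `[j.+1%:R^-1, j.+2%:R].

Lemma slab_nondecreasing : nondecreasing_seq slab.
Proof.
move=> i j ij; rewrite subsetEset => x; rewrite /slab /= !in_itv/= => /andP[ix xi].
apply/andP; split.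
  by apply: le_trans ix; rewrite lef_pV2 ?posrE ?ltr0n// ler_nat ltnS.
by apply: le_trans xi _; rewrite ler_nat !ltnS.
Qed.

Lemma slab_bigcup : \bigcup_j slab j = `]0%R, +oo[%classic.
Proof.
apply/seteqP; split => x /=.
  move=> [j _]; rewrite /slab /= !in_itv/= andbT => /andP[+ _].
  by apply: lt_le_trans; rewrite invr_gt0 ltr0n.
rewrite in_itv/= andbT => x0.
have xy0 : 0 < x + x^-1 by rewrite addr_gt0 // invr_gt0.
exists (Num.truncn (x + x^-1)) => //; rewrite /slab /= in_itv/=.
have xl : x + x^-1 < (Num.truncn (x + x^-1)).+1%:R by apply: truncnS_gt.
apply/andP; split.
  rewrite invf_ple ?posrE ?ltr0n//; apply: ltW; apply: le_lt_trans xl.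
  by rewrite lerDr ltW.
apply: ltW; apply: lt_trans (_ : _ < (Num.truncn (x + x^-1)).+1%:R) _.
  by apply: le_lt_trans xl; rewrite lerDl invr_ge0 ltW.
by rewrite ltr_nat.
Qed.

Lemma slab_subset j : slab j `<=` `]0%R, +oo[%classic.
Proof. by rewrite -slab_bigcup; apply: bigcup_sup. Qed.

Lemma measurable_powR_expR c s (D : set R) :
  measurable_fun D (fun t => t `^ s * expR (- (c * t))).
Proof.
apply: measurable_funM; first by apply: measurable_funTS; exact: measurable_powR.
apply: measurableT_comp; first exact: measurable_expR.
by apply: measurableT_comp => //; apply: measurable_funM.
Qed.

Lemma mellin_slab_cvg c s :
  (\int[mu]_(t in slab j) (t `^ (s - 1) * expR (- (c * t)))%:E)%E @[j --> \oo]
    --> mellin_exp c s.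
Proof.
rewrite /mellin_exp -slab_bigcup; apply: ge0_nondecreasing_set_cvg_integral.
- exact: slab_nondecreasing.
- by move=> i; exact: measurable_itv.
- by move=> i; apply/measurable_EFinP; exact: measurable_powR_expR.
- by move=> i x _; rewrite lee_fin mulr_ge0 ?powR_ge0 ?expR_ge0.
Qed.

(** As [ln x <= x], polynomial growth is beaten by any exponential. *)
Lemma powR_le_expR s e t : 0 < e -> 0 <= s -> 0 < t ->
  t `^ s <= expR (- (s * ln e)) * expR (s * (e * t)).
Proof.
move=> e0 s0 t0; rewrite /powR gt_eqF// -expRD ler_expR -mulrN -mulrDr.
apply: ler_wpM2l => //; rewrite addrC -lerBlDr opprK -lnM ?posrE//.
by rewrite [leLHS](_ : _ = ln (e * t)) 1?mulrC//; apply: ltW; apply: ln_sublinear; rewrite mulr_gt0.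
Qed.

Lemma powR_expR_le c s : 0 < c -> 0 <= s ->
  exists K, 0 <= K /\ forall t, 0 < t -> t `^ s * expR (- (c * t)) <= K * expR (- (c / 2 * t)).
Proof.
move=> c0 s0; pose e := c / (2 * (s + 1)).
have e0 : 0 < e by rewrite divr_gt0// mulr_gt0// ltr_wpDl.
exists (expR (- (s * ln e))); split; first exact: expR_ge0.
move=> t t0; apply: le_trans (ler_wpM2r (expR_ge0 _) (powR_le_expR e0 s0 t0)) _.
rewrite -[leLHS]mulrA; apply: ler_wpM2l; rewrite ?expR_ge0// -expRD ler_expR.
have se : s * e <= c / 2.
  have -> : s * e = c / 2 * (s / (s + 1)) by rewrite /e; field; apply/eqP; lra.
  by rewrite ger_pMr ?divr_gt0// ler_pdivrMr ?ltr_wpDl// mul1r lerDl.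
by have := ler_wpM2r (ltW t0) se; lra.
Qed.

Lemma mellin_exp_lty_gt1 c s : 0 < c -> 1 <= s -> (mellin_exp c s < +oo)%E.
Proof.
move=> c0 s1; have [|K [K0 HK]] := @powR_expR_le c (s - 1) c0.
  by rewrite subr_ge0.
have r0 : 0 < c / 2 by rewrite divr_gt0.
apply: (@le_lt_trans _ _ (\int[mu]_(t in `]0%R, +oo[)
    ((K * (c / 2)^-1)%:E * (exponential_pdf (c / 2) t)%:E))%E).
  apply: ge0_le_integral => //.
  - by move=> x _; rewrite lee_fin mulr_ge0 ?powR_ge0 ?expR_ge0.
  - by apply/measurable_EFinP; exact: measurable_powR_expR.
  - apply/measurable_EFinP; apply: measurable_funM => //; apply: measurable_funTS.
    exact: measurable_exponential_pdf.
  - move=> t /=; rewrite in_itv/= andbT => t0; rewrite lee_fin.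
    have -> : exponential_pdf (c / 2) t = c / 2 * expR (- (c / 2) * t).
      by rewrite exponential_pdfE// ltW.
    by rewrite mulrA divfK ?gt_eqF// mulNr; exact: HK.
rewrite ge0_integralZl_EFin//.
- apply: lte_mul_pinfty => //.
    by rewrite lee_fin mulr_ge0// invr_ge0 ltW.
  apply: (@le_lt_trans _ _ (\int[mu]_t (exponential_pdf (c / 2) t)%:E)%E).
    apply: ge0_subset_integral => //.
      by apply/measurable_EFinP; exact: measurable_exponential_pdf.
    by move=> x _; rewrite lee_fin; apply: exponential_pdf_ge0; exact: ltW.
  by rewrite integral_exponential_pdf// ltry.
- by move=> x _; rewrite lee_fin; apply: exponential_pdf_ge0; exact: ltW.
- by apply/measurable_EFinP; apply: measurable_funTS; exact: measurable_exponential_pdf.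
- by rewrite mulr_ge0// invr_ge0 ltW.
Qed.

Lemma mellin_exp_gt0 c s : 0 <= c -> 0 <= s -> (0 < mellin_exp c s)%E.
Proof.
move=> c0 s0.
apply: (@lt_le_trans _ _ (\int[mu]_(t in `[1%R, 2%R]) (2^-1 * expR (- (c * 2)))%:E)%E).
  rewrite integral_cst//= lebesgue_measure_itv/= lte_fin ltr1n/=.
  by rewrite -EFinD -EFinM lte_fin; apply: mulr_gt0; rewrite ?mulr_gt0 ?expR_gt0// subr_gt0 ltr1n.
apply: (@le_trans _ _ (\int[mu]_(t in `[1%R, 2%R]) (t `^ (s - 1) * expR (- (c * t)))%:E)%E).
  apply: ge0_le_integral => //.
  - by apply/measurable_EFinP; exact: measurable_powR_expR.
  - move=> t /=; rewrite in_itv/= => /andP[t1 t2]; rewrite lee_fin ler_pM//.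
    + apply: (@le_trans _ _ (t `^ (-1))).
        by rewrite powR_inv1 ?(le_trans ler01)// lef_pV2 ?posrE// (lt_le_trans ltr01).
      by rewrite ler_powR// lerBrDr addNr.
    + by rewrite ler_expR lerN2 ler_wpM2l.
apply: ge0_subset_integral => //.
- by apply/measurable_EFinP; exact: measurable_powR_expR.
- by move=> x _; rewrite lee_fin mulr_ge0 ?powR_ge0 ?expR_ge0.
- move=> t /=; rewrite !in_itv/= andbT => /andP[t1 _]; exact: lt_le_trans t1.
Qed.

Lemma powR_expR_slab_cvg c s : 0 < c -> 0 < s ->
  (j.+2%:R `^ s * expR (- (c * j.+2%:R)) - (j.+1%:R^-1) `^ s * expR (- (c * j.+1%:R^-1)))
     @[j --> \oo] --> 0.
Proof.
move=> c0 s0; rewrite -[X in _ --> X](subr0 0); apply: cvgB.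
  have [K [K0 HK]] := powR_expR_le c0 (ltW s0).
  have r0 : 0 < c / 2 by rewrite divr_gt0.
  apply: (@squeeze_cvgr _ _ _ _ (cst 0) (fun j : nat => K * expR (- (c / 2 * j.+2%:R)))).
  - by apply: nearW => j; rewrite mulr_ge0 ?powR_ge0 ?expR_ge0//= HK.
  - exact: cvg_cst.
  rewrite -(mulr0 K); apply: cvgM; first exact: cvg_cst.
  have dvg : (j.+2%:R : R) @[j --> \oo] --> +oo.
    apply/cvgrnyP; rewrite (_ : (fun j => j.+2) = (fun j => (j + 2)%N)).
      exact: cvg_addnr.
    by apply/funext => j; rewrite addn2.
  have dvgM : (c / 2 * x) @[x --> +oo] --> +oo by apply: gt0_cvgMry => //; exact: cvg_id.
  exact: (cvg_comp _ _ dvg (cvg_comp _ _ dvgM (@cvgr_expR R))).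
apply: (@squeeze_cvgr _ _ _ _ (cst 0) (fun j : nat => (j.+1%:R^-1) `^ s)).
- apply: nearW => j; rewrite mulr_ge0 ?powR_ge0 ?expR_ge0//=.
  by rewrite ler_piMr ?powR_ge0// expR_le1 oppr_le0 mulr_ge0 ?invr_ge0 ?ler0n// ltW.
- exact: cvg_cst.
apply: (cvg_at_rightP (fun x : R => x `^ s) 0 0).1; first exact: powR_cvg0.
split; first by move=> j; rewrite invr_gt0 ltr0n.
exact: (@cvg_harmonic R).
Qed.

(** Integration by parts on a slab, of [exp (- c t)] against the derivative of
    [t^s]. *)
Lemma mellin_slab_by_parts c s j : 0 < c -> 0 < s ->
  (s%:E * \int[mu]_(t in slab j) (t `^ (s - 1) * expR (- (c * t)))%:E
   = (j.+2%:R `^ s * expR (- (c * j.+2%:R)) - (j.+1%:R^-1) `^ s * expR (- (c * j.+1%:R^-1)))%:E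
    + c%:E * \int[mu]_(t in slab j) (t `^ (s + 1 - 1) * expR (- (c * t)))%:E)%E.
Proof.
move=> c0 s0; have j0 : (0 : R) < j.+1%:R^-1 by rewrite invr_gt0 ltr0n.
have jj : (j.+1%:R^-1 : R) < j.+2%:R.
  by apply: (@le_lt_trans _ _ 1); rewrite ?ltr1n// invf_le1 ?ltr0n// ler1n.
have slab_gt0 x : slab j x -> 0 < x.
  by move=> /slab_subset; rewrite /= in_itv/= andbT.
have Zl k e : 0 <= k ->
    (k%:E * \int[mu]_(t in slab j) (t `^ e * expR (- (c * t)))%:E
     = \int[mu]_(t in slab j) (k * (t `^ e * expR (- (c * t))))%:E)%E.
  move=> k0; rewrite -ge0_integralZl_EFin//.
  - exact: measurable_itv.
  - by move=> x _; rewrite lee_fin mulr_ge0 ?powR_ge0 ?expR_ge0.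
  - by apply/measurable_EFinP; exact: measurable_powR_expR.
have dE (x : R) : is_derive x 1 (fun t => expR (- (c * t))) (- c * expR (- (c * x))).
  have -> : (fun t => expR (- (c * t))) = expR \o ( *%R (- c)) by apply/funext => t /=; rewrite mulNr.
  by apply: is_derive_eq; rewrite [_%:A]mulr1 mulNr mulrC.
have dP (x : R) : 0 < x -> is_derive x 1 (fun t => t `^ s) (s * x `^ (s - 1)).
  exact: is_derive1_powR.
have cE (x : R) : {for x, continuous (fun t => expR (- (c * t)))}.
  by apply: differentiable_continuous; apply/derivable1_diffP; case: (dE x).
have cP e (x : R) : 0 < x -> {for x, continuous (fun t => t `^ e)}.
  move=> x0; apply: differentiable_continuous; apply/derivable1_diffP.
  by apply: derivable_powR; rewrite in_itv/= andbT.
have := @integration_by_parts R (fun t => expR (- (c * t))) (fun t => t `^ s)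
  (fun t => - c * expR (- (c * t))) (fun t => s * t `^ (s - 1)) _ _ jj.
rewrite !Zl ?ltW// => H.
have -> : (\int[mu]_(t in slab j) (s * (t `^ (s - 1) * expR (- (c * t))))%:E =
   \int[mu]_(x in `[j.+1%:R^-1%R, j.+2%:R%R]) (expR (- (c * x)) * (s * x `^ (s - 1)))%:E)%E.
  by apply: eq_integral => x _; congr EFin; ring.
rewrite H; first last.
- by move=> x /[!in_itv]/= /andP[x0 _]; rewrite derive1E; have [_ ->] := dP x (lt_trans j0 x0).
- split.
  + by move=> x; rewrite in_itv/= => /andP[x0 _]; case: (dP x _) => //; exact: lt_trans x0.
  + by apply: cvg_at_right_filter; apply: cP.
  + by apply: cvg_at_left_filter; apply: cP; exact: lt_trans jj.
- apply: continuous_in_subspaceT => x /set_mem /slab_gt0 x0.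
  by apply: cvgM; [exact: cvg_cst | exact: cP].
- by move=> x _; rewrite derive1E; have [_ ->] := dE x.
- split.
  + by move=> x _; case: (dE x).
  + by apply: cvg_at_right_filter; exact: cE.
  + by apply: cvg_at_left_filter; exact: cE.
- apply: continuous_in_subspaceT => x _.
  by apply: cvgM; [exact: cvg_cst | exact: cE].
congr (_ + _)%E; first by congr EFin; ring.
rewrite -[RHS]oppeK; congr (- _)%E; rewrite -integral_ge0N; last first.
  by move=> x _; rewrite lee_fin !mulr_ge0 ?powR_ge0 ?expR_ge0// ltW.
apply: eq_integral => x _; rewrite -EFinN addrK; congr EFin; ring.
Qed.

(** The functional equation of the Gamma function: the boundary terms vanish as
    the slabs grow. *)
Lemma mellin_expS c s : 0 < c -> 0 < s ->
  (s%:E * mellin_exp c s = c%:E * mellin_exp c (s + 1))%E.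
Proof.
move=> c0 s0.
have s1 : mellin_exp c (s + 1) \is a fin_num.
  by rewrite ge0_fin_numE ?mellin_exp_lty_gt1 ?lerDr ?ltW// mellin_exp_gt0 ?addr_ge0// ltW.
have L : (s%:E * \int[mu]_(t in slab j) (t `^ (s - 1) * expR (- (c * t)))%:E
    @[j --> \oo] --> s%:E * mellin_exp c s)%E.
  by apply: cvgeZl => //; exact: mellin_slab_cvg.
have Rr : (s%:E * \int[mu]_(t in slab j) (t `^ (s - 1) * expR (- (c * t)))%:E
    @[j --> \oo] --> 0 + c%:E * mellin_exp c (s + 1))%E.
  under eq_fun do rewrite mellin_slab_by_parts//.
  apply: cvgeD.
  - by rewrite fin_num_adde_defr.
  - by apply: cvg_EFin; [exact: nearW | exact: powR_expR_slab_cvg].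
  - by apply: cvgeZl => //; exact: mellin_slab_cvg.
by rewrite (cvg_unique _ L Rr) ?add0e//; apply: ereal_hausdorff.
Qed.

(** For [s < 1] the singularity at [0] is removed by the functional equation,
    read as a formula for the value at [s]. *)
Lemma mellin_exp_fin_num c s : 0 < c -> 0 < s -> mellin_exp c s \is a fin_num.
Proof.
move=> c0 s0.
have s1 : mellin_exp c (s + 1) \is a fin_num.
  by rewrite ge0_fin_numE ?mellin_exp_lty_gt1 ?lerDr ?ltW// mellin_exp_gt0 ?addr_ge0// ltW.
have H := mellin_expS c0 s0; have P := mellin_exp_gt0 (ltW c0) (ltW s0).
move: H P; case: (mellin_exp c s) => [//||//].
rewrite mulry gtr0_sg// mul1e => H.
have : (c%:E * mellin_exp c (s + 1))%E \is a fin_num by rewrite fin_numM.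
by rewrite -H.
Qed.

End Mellin.

Section Gamma.
Context {R : realType}.
Implicit Types (c s t : R).

Lemma eulerGamma_gt0 s : 0 < s -> 0 < eulerGamma s.
Proof.
move=> s0; have -> : eulerGamma s = fine (mellin_exp 1 s).
  by rewrite /eulerGamma /Rintegral /mellin_exp; under [in RHS]eq_integral do rewrite mul1r.
rewrite fine_gt0// mellin_exp_gt0 ?ltW//=.
by rewrite ltey_eq mellin_exp_fin_num.
Qed.

(** Needed because the inverse of [Gamma (- sigma)] is a factor of the jump
    kernel, which would vanish identically if that value were [0]. *)
Lemma Gamma_neg_neq0 s : 0 < s < 1 -> Gamma (- s) != 0.
Proof.
move=> /andP[s0 s1]; rewrite /Gamma ifF; last by rewrite oppr_gt0 ltNge ltW.
have -> : Num.floor (- s) = -1.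
  by apply/eqP; rewrite floor_eq addNr; apply/andP; split; lra.
rewrite abszN1 big_ord_recl big_ord0 mulr1 addr0.
by rewrite mulf_neq0// ?invr_eq0 ?oppr_eq0 ?gt_eqF//; apply: eulerGamma_gt0; lra.
Qed.

End Gamma.

(** * Cauchy products of absolutely convergent series *)
Section CauchyProduct.
Context {R : realType}.
Implicit Types (a b : R^nat).

Definition convolution a b : R^nat := fun n => \sum_(i < n.+1) a i * b (n - i)%N.

Lemma series_ord a n : series a n = \sum_(i < n) a i.
Proof. by rewrite seriesEord. Qed.

Lemma series_convolution a b n :
  series (convolution a b) n = \sum_(i < n) a i * series b (n - i)%N.
Proof.
elim: n => [|n IH]; first by rewrite seriesEnat/= big_geq// big_ord0.
rewrite seriesSr IH /convolution !big_ord_recr/= subnn subSnn addrA -big_split/=.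
congr (_ + _); last by rewrite seriesSr seriesEnat/= big_geq// add0r.
apply: eq_bigr => i _; rewrite -mulrDr -seriesSr; congr (_ * series _ _).
by rewrite subSn// ltnW.
Qed.

Lemma series_nneg_nondecreasing a : (forall n, 0 <= a n) -> nondecreasing_seq (series a).
Proof. by move=> a0; apply: nondecreasing_series => i _ _; exact: a0. Qed.

Lemma series_ge0 a n : (forall n, 0 <= a n) -> 0 <= series a n.
Proof. by move=> a0; rewrite seriesEnat/= sumr_ge0. Qed.

Lemma nneseries_EFin (v : R^nat) : cvgn (series v) ->
  (\sum_(k <oo) (v k)%:E = (limn (series v))%:E)%E.
Proof.
move=> cv; rewrite -EFin_lim//; congr (limn _).
by apply/funext => n /=; rewrite sumEFin.
Qed.

Let nrm a : R^nat := fun n => `|a n|.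

(** For nonnegative terms the triangular partial sums [T] and the square ones
    [S] interlace as [T n <= S n <= T (2 n)], so [S - T] vanishes in the
    limit; in general [|S - T|] is dominated by the same difference for the
    absolute values. *)
Lemma cauchy_product a b : cvgn (series (nrm a)) -> cvgn (series (nrm b)) ->
  series (convolution a b) @ \oo --> limn (series a) * limn (series b).
Proof.
move=> ca cb.
have ca' := normed_cvg ca; have cb' := normed_cvg cb.
pose T := series (convolution (nrm a) (nrm b)).
pose S n := series (nrm a) n * series (nrm b) n.
have nb := series_nneg_nondecreasing (fun n => normr_ge0 (b n)).
have na := series_nneg_nondecreasing (fun n => normr_ge0 (a n)).
have TE n : T n = \sum_(i < n) nrm a i * series (nrm b) (n - i)%N by exact: series_convolution.
have SE n : S n = \sum_(i < n) nrm a i * series (nrm b) n.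
  by rewrite /S series_ord mulr_suml.
have TS n : T n <= S n.
  rewrite TE SE; apply: ler_sum => i _; apply: ler_wpM2l; first exact: normr_ge0.
  by apply: nb; exact: leq_subr.
have ST n : S n <= T (n + n)%N.
  rewrite TE SE big_split_ord/= -[leLHS]addr0; apply: lerD; last first.
    apply: sumr_ge0 => i _; apply: mulr_ge0; first exact: normr_ge0.
    by apply: series_ge0 => k; exact: normr_ge0.
  apply: ler_sum => i _; apply: ler_wpM2l; first exact: normr_ge0.
  by apply: nb; rewrite -addnBA ?leq_addr// ltnW.
have Tnd : nondecreasing_seq T.
  by apply: series_nneg_nondecreasing => n; apply: sumr_ge0 => i _; apply: mulr_ge0; exact: normr_ge0.
have cS : S @ \oo --> limn (series (nrm a)) * limn (series (nrm b)) by apply: cvgM.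
have cT : cvgn T.
  apply: nondecreasing_is_cvgn => //.
  exists (limn (series (nrm a)) * limn (series (nrm b))) => _ [n _ <-].
  apply: le_trans (TS n) _; apply: ler_pM; rewrite ?nondecreasing_cvgn_le//.
  - by apply: series_ge0 => k; exact: normr_ge0.
  - by apply: series_ge0 => k; exact: normr_ge0.
have cT2 : T (n + n)%N @[n --> \oo] --> limn T.
  have dvg : (n + n)%N @[n --> \oo] --> \oo.
    apply/cvgnyPge => A; near=> n; rewrite (@leq_trans n) ?leq_addr//.
    by near: n; exact: nbhs_infty_ge.
  exact: (cvg_comp _ _ dvg cT).
have ST0 : (S n - T n) @[n --> \oo] --> 0.
  apply: (@squeeze_cvgr _ _ _ _ (cst 0) (fun n => T (n + n)%N - T n)).
  - by apply: nearW => n; rewrite subr_ge0 TS lerD2r ST.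
  - exact: cvg_cst.
  - by rewrite -(subrr (limn T)); apply: cvgB.
have D0 : (series a n * series b n - series (convolution a b) n) @[n --> \oo] --> 0.
  apply: norm_cvg0; apply: (@squeeze_cvgr _ _ _ _ (cst 0) (fun n => S n - T n)) => //;
    last exact: cvg_cst.
  apply: nearW => n; rewrite normr_ge0/= series_convolution (series_ord a) mulr_suml -sumrB.
  rewrite SE TE -sumrB; apply: le_trans (ler_norm_sum _ _ _) _; apply: ler_sum => i _.
  rewrite -!mulrBr normrM; apply: ler_wpM2l; first exact: normr_ge0.
  by rewrite !sub_series_geq ?leq_subr// ler_norm_sum.
have -> : series (convolution a b) = (fun n => series a n * series b n
    - (series a n * series b n - series (convolution a b) n)).
  by apply/funext => n; rewrite subKr.
by rewrite -[X in _ --> X]subr0; apply: cvgB => //; apply: cvgM.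
Unshelve. all: by end_near. Qed.

End CauchyProduct.

(** * The heat kernel as a series with positive terms *)
Section HeatKernel.
Context {R : realType}.
Implicit Types (f : int -> R) (x y : int) (t : R).

(** The expansion of the [m]-th power of a sum of two commuting operators,
    read off on an array whose two indices count the applications of each. *)
Lemma binomial_array (F : nat -> nat -> nat -> R) :
  (forall m i l, F m.+1 i l = F m i.+1 l + F m i l.+1) ->
  forall m i l, F m i l = \sum_(a < m.+1) 'C(m, a)%:R * F 0%N (i + a)%N (l + (m - a))%N.
Proof.
move=> FS; elim=> [|m IH] i l; first by rewrite big_ord_recl big_ord0 /= bin0 mul1r subn0 !addn0 addr0.
rewrite FS !IH addrC.
transitivity (\sum_(a < m.+2) 'C(m, a)%:R * F 0%N (i + a)%N (l + (m.+1 - a))%N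
    + \sum_(a < m.+1) 'C(m, a)%:R * F 0%N (i + a.+1)%N (l + (m - a))%N).
  congr (_ + _); last by apply: eq_bigr => a _; rewrite addSnnS.
  rewrite [RHS]big_ord_recr/= bin_small// mul0r addr0; apply: eq_bigr => a _.
  by rewrite addSnnS subSn// -ltnS.
rewrite big_ord_recl [RHS]big_ord_recl !bin0 -addrA; congr (_ + _).
rewrite -big_split; apply: eq_bigr => a _.
by rewrite /= /bump/= !add1n binS natrD mulrDl subSS.
Qed.

(** [lapl = 2 - nbr_sum]. *)
Definition nbr_sum f : int -> R := fun x => f (x - 1) + f (x + 1).

Lemma iter_nbr_sum_lapl l f x :
  iter l nbr_sum (lapl f) x = 2 * iter l nbr_sum f x - iter l.+1 nbr_sum f x.
Proof.
elim: l x => [|l IH] x; first by rewrite /= /lapl /nbr_sum opprD addrA.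
by rewrite iterS /nbr_sum !IH /= /nbr_sum; ring.
Qed.

(** Binomial expansion of the sum of the left and right shifts. *)
Lemma iter_nbr_sumE n f x :
  iter n nbr_sum f x = \sum_(a < n.+1) 'C(n, a)%:R * f (x - a%:Z + (n - a)%N%:Z).
Proof.
pose F m i l := iter m nbr_sum f (x - i%:Z + l%:Z).
have FS m i l : F m.+1 i l = F m i.+1 l + F m i l.+1.
  by rewrite /F iterS /nbr_sum; congr (_ + _); congr (iter m nbr_sum f _); lia.
have := binomial_array FS n 0%N 0%N; rewrite /F subr0 addr0 => ->.
by apply: eq_bigr => a _; rewrite !add0n.
Qed.

(** The binomial expansion of [(2 - nbr_sum)^m], divided by [m!], is the [m]-th
    coefficient of [exp (-2 t)] times [exp (t nbr_sum)]. *)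
Lemma heat_coeffE t f x m :
  exp_coeff (- t) m * iter m (@lapl R) f x
  = convolution (exp_coeff (- (2 * t))) (fun n => exp_coeff t n * iter n nbr_sum f x) m.
Proof.
have -> : iter m (@lapl R) f x = \sum_(a < m.+1) 'C(m, a)%:R *
    (2 ^+ a * (-1) ^+ (m - a) * iter (m - a)%N nbr_sum f x).
  pose F m i l := 2 ^+ i * (-1) ^+ l * iter l nbr_sum (iter m (@lapl R) f) x.
  have FS k i l : F k.+1 i l = F k i.+1 l + F k i l.+1.
    by rewrite /F [iter k.+1 (@lapl R) f]iterS iter_nbr_sum_lapl !exprS; ring.
  (* [i] and [l] count the factors [2] and [- nbr_sum] already split off. *)
  have -> : iter m (@lapl R) f x = F m 0%N 0%N by rewrite /F !expr0 !mul1r.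
  rewrite (binomial_array FS).
  by apply: eq_bigr => a _; rewrite !add0n.
rewrite /convolution mulr_sumr; apply: eq_bigr => a _.
have am : (a <= m)%N by rewrite -ltnS.
rewrite /exp_coeff/= -(bin_fact am) !natrM.
have a0 : (a`!%:R : R) != 0 by rewrite pnatr_eq0 -lt0n fact_gt0.
have b0 : ((m - a)`!%:R : R) != 0 by rewrite pnatr_eq0 -lt0n fact_gt0.
have c0 : ('C(m, a)%:R : R) != 0 by rewrite pnatr_eq0 -lt0n bin_gt0.
rewrite -{1}(subnKC am) exprD (exprNn (2 * t)) exprMn (exprNn t a) (exprNn t (m - a)).
have e2 : (-1) ^+ (m - a) * (-1) ^+ (m - a) = 1 :> R.
  by rewrite -exprD addnn -muln2 mulnC exprM sqrrN expr1n expr1n.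
transitivity ((-1) ^+ (m - a) * (-1) ^+ (m - a) * ((-1) ^+ a * (2 ^+ a * t ^+ a) / a`!%:R *
   (t ^+ (m - a) / (m - a)`!%:R * iter (m - a)%N nbr_sum f x))); last by rewrite e2 mul1r.
by field; rewrite a0 b0 c0.
Qed.

Lemma iter_nbr_sum_indic n x y : iter n nbr_sum (\1_[set y]) x
  = \sum_(a < n.+1) 'C(n, a)%:R * (x - a%:Z + (n - a)%N%:Z == y)%:R.
Proof.
rewrite iter_nbr_sumE; apply: eq_bigr => a _; rewrite indicE; congr (_ * _%:R).
by congr nat_of_bool; apply/idP/eqP => [/set_mem//|->]; apply: mem_set.
Qed.

Lemma iter_nbr_sum_indic_eq0 n x y :
  (forall k, n != `|x - y| + k.*2)%N -> iter n nbr_sum (\1_[set y]) x = 0.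
Proof.
move=> nE; rewrite iter_nbr_sum_indic big1// => a _.
have an : (a <= n)%N by rewrite -ltnS.
case: eqP => [xy|]; last by rewrite mulr0.
(* The steps that cancel out come in [minn a (n - a)] pairs. *)
have := nE (minn a (n - a)); rewrite -addnn; lia.
Qed.

(** Walks of [n + 2 k] steps covering the distance [n] take exactly [k] steps
    away from the target. *)
Lemma iter_nbr_sum_indicE k x y :
  iter (`|x - y| + k.*2)%N nbr_sum (\1_[set y]) x = 'C(`|x - y| + k.*2, k)%:R.
Proof.
rewrite iter_nbr_sum_indic; set n := `|x - y|%N.
have [j jn [jC jE]] : exists2 j : nat, (j < (n + k.*2).+1)%N &
    'C(n + k.*2, j) = 'C(n + k.*2, k) /\
    forall a : nat, (a <= n + k.*2)%N -> (x - a%:Z + (n + k.*2 - a)%N%:Z == y) = (a == j).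
  have [xy|xy] := lerP 0 (x - y).
    exists (n + k)%N; first by rewrite -addnn; lia.
    split; last by move=> a an; apply/eqP/eqP; rewrite /n -addnn in an *; lia.
    by rewrite -bin_sub -?addnn; [congr 'C(_, _); lia | lia].
  exists k; first by rewrite -addnn; lia.
  by split=> // a an; apply/eqP/eqP; rewrite /n -addnn in an *; lia.
rewrite (bigD1 (Ordinal jn))//= (jE j) ?eqxx ?mulr1 ?jC; last by rewrite -ltnS.
rewrite big1 ?addr0// => a aj; rewrite (jE a (leq_ord a)).
by rewrite (_ : (a == j :> nat) = false) ?mulr0//; apply/negbTE.
Qed.

(** Coefficients of [t^(n + 2 k)] in the modified Bessel function [I_n (2 t)]. *)
Definition bessel_coeff (n k : nat) : R := (k`!%:R * (n + k)`!%:R)^-1.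

Lemma bessel_coeff_gt0 n k : 0 < bessel_coeff n k.
Proof. by rewrite invr_gt0 mulr_gt0// ltr0n fact_gt0. Qed.

Lemma exp_coeff_nbr_sum t k x y (n := `|x - y|%N) :
  exp_coeff t (n + k.*2) * iter (n + k.*2)%N nbr_sum (\1_[set y]) x
  = t ^+ (n + k.*2) * bessel_coeff n k.
Proof.
rewrite iter_nbr_sum_indicE /exp_coeff/= /bessel_coeff.
have kn : (k <= n + k.*2)%N by rewrite -addnn; lia.
rewrite -(bin_fact kn) (_ : n + k.*2 - k = n + k)%N; last by rewrite -addnn; lia.
have a0 : (k`!%:R : R) != 0 by rewrite pnatr_eq0 -lt0n fact_gt0.
have b0 : ((n + k)`!%:R : R) != 0 by rewrite pnatr_eq0 -lt0n fact_gt0.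
have c0 : ('C(n + k.*2, k)%:R : R) != 0 by rewrite pnatr_eq0 -lt0n bin_gt0.
by rewrite !natrM; field; rewrite a0 b0 c0.
Qed.

Lemma iter_nbr_sum_indic_bound n x y :
  0 <= iter n nbr_sum (\1_[set y]) x <= (2 ^+ n : R).
Proof.
rewrite iter_nbr_sum_indic; apply/andP; split.
  by apply: sumr_ge0 => a _; rewrite mulr_ge0.
have -> : (2 ^+ n : R) = \sum_(a < n.+1) 'C(n, a)%:R.
  rewrite -natrX -natr_sum; congr (_%:R); rewrite -[2%N]/(1 + 1)%N expnDn.
  by apply: eq_bigr => a _; rewrite !exp1n !muln1.
by apply: ler_sum => a _; case: eqP; rewrite ?mulr1// mulr0.
Qed.

(** By parity only every other term of the exponential series is nonzero, and
    none before the [n]-th. *)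
Lemma series_bessel_sub t x y (n := `|x - y|%N) K :
  series (fun k => t ^+ (n + k.*2) * bessel_coeff n k) K
  = series (fun m => exp_coeff t m * iter m nbr_sum (\1_[set y]) x) (n + K.*2)%N.
Proof.
elim: K => [|K IH].
  rewrite !series_ord big_ord0 addn0 big1// => m _; rewrite iter_nbr_sum_indic_eq0 ?mulr0// => k.
  by apply/eqP => mE; have := ltn_ord m; rewrite mE -/n; lia.
rewrite seriesSr IH doubleS !addnS !seriesSr.
rewrite (@iter_nbr_sum_indic_eq0 (n + K.*2).+1) ?mulr0 ?addr0.
  by rewrite exp_coeff_nbr_sum.
by move=> k; rewrite -/n; apply/eqP; lia.
Qed.

(** The heat kernel is [exp (-2 t) I_n (2 t)]. *)
Lemma heat_indicE t x y (n := `|x - y|%N) : 0 <= t ->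
  cvgn (series (fun k => t ^+ (n + k.*2) * bessel_coeff n k)) /\
  heat t (\1_[set y]) x =
    expR (- (2 * t)) * limn (series (fun k => t ^+ (n + k.*2) * bessel_coeff n k)).
Proof.
move=> t0; pose g m := exp_coeff t m * iter m nbr_sum (\1_[set y]) x.
have cg : cvgn (series (fun m => `|g m|)).
  apply: (@series_le_cvg _ _ (exp_coeff (2 * t))).
  - by move=> m.
  - by move=> m; apply: exp_coeff_ge0; rewrite mulr_ge0.
  - move=> m; have /andP[i0 i2] := iter_nbr_sum_indic_bound m x y.
    rewrite ger0_norm; last by rewrite /g mulr_ge0 ?exp_coeff_ge0.
    have -> : exp_coeff (2 * t) m = exp_coeff t m * 2 ^+ m.
      by rewrite /exp_coeff/= exprMn (mulrC (2 ^+ m)) mulrAC.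
    by apply: ler_wpM2l => //; exact: exp_coeff_ge0.
  - exact: is_cvg_series_exp_coeff.
have cg' : cvgn (series g) by exact: normed_cvg.
have sub : series (fun k => t ^+ (n + k.*2) * bessel_coeff n k) @ \oo --> limn (series g).
  rewrite (_ : series _ = (fun K => series g (n + K.*2)%N)); last first.
    by apply/funext => K; exact: series_bessel_sub.
  have dvg : (n + K.*2)%N @[K --> \oo] --> \oo.
    apply/cvgnyPge => A; near=> K; rewrite (@leq_trans K) -?addnn ?addnA ?leq_addl//.
    by near: K; exact: nbhs_infty_ge.
  exact: (cvg_comp _ _ dvg cg').
split; first by apply/cvg_ex; eexists; exact: sub.
rewrite (cvg_lim _ sub)//.
have ce : cvgn (series (fun m => `|exp_coeff (- (2 * t)) m|)).
  have -> : series (fun m => `|exp_coeff (- (2 * t)) m|) = [normed series (exp_coeff (- (2 * t)))] by [].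
  by rewrite normed_series_exp_coeff; exact: is_cvg_series_exp_coeff.
have -> : heat t (\1_[set y]) x = limn (series (convolution (exp_coeff (- (2 * t))) g)).
  by rewrite /heat; congr (limn (series _)); apply/funext => m; exact: heat_coeffE.
by rewrite (cvg_lim _ (cauchy_product ce cg)).
Unshelve. all: by end_near. Qed.

End HeatKernel.

(** * A hypergeometric series and its recurrence *)
Section KernelSeries.
Context {R : realType}.
Variable sigma : R.
Hypothesis sigma01 : 0 < sigma < 1.
Implicit Types (n k : nat).

Let sigma_gt0 : 0 < sigma. Proof. by case/andP: sigma01. Qed.
Let sigma_lt1 : sigma < 1. Proof. by case/andP: sigma01. Qed.

(** [T n k] is only known through its ratios in each index; it is, up to a
    factor, [Gamma (n + 2 k - sigma) / (2^(n + 2 k) k! (n + k)!)]. *)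
Variable T : nat -> nat -> R.
Hypothesis T_gt0 : forall n k, (0 < n)%N -> 0 < T n k.
Hypothesis T_Sl : forall n k, (0 < n)%N ->
  T n.+1 k = ((n + k.*2)%:R - sigma) / (2 * (n + k).+1%:R) * T n k.
Hypothesis T_Sr : forall n k, (0 < n)%N ->
  T n k.+1 = ((n + k.*2)%:R - sigma) * ((n + k.*2)%:R + 1 - sigma)
    / (4 * k.+1%:R * (n + k).+1%:R) * T n k.

Definition kernel n : R := limn (series (T n)).

(** From this index on, [k T n k] decreases by at least [T n k / 4] at each
    step. *)
Let K0 n := (n.+1 ^ 2)%N.

Lemma term_telescope n k : (0 < n)%N -> (K0 n <= k)%N ->
  T n k <= 4 * (k%:R * T n k - k.+1%:R * T n k.+1).
Proof.
move=> n0 k0; rewrite T_Sr//; set Tk := T n k.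
have T0 : 0 < Tk by exact: T_gt0.
have d0 : (k.+1%:R : R) != 0 by rewrite pnatr_eq0.
have c0 : (0 : R) < (n + k).+1%:R by rewrite ltr0n.
set A := (n + k.*2)%:R - sigma; set B := (n + k.*2)%:R + 1 - sigma.
have -> : 4 * (k%:R * Tk - k.+1%:R * (A * B / (4 * k.+1%:R * (n + k).+1%:R) * Tk))
   = Tk * ((4 * k%:R * (n + k).+1%:R - A * B) / (n + k).+1%:R).
  by move: (k.+1%:R : R) d0 ((n + k).+1%:R : R) c0 => d d0 c c0; field; rewrite d0 gt_eqF.
rewrite -[leLHS]mulr1 ler_pM2l// ler_pdivlMr// mul1r /A /B.
have -> : (n + k.*2)%:R = n%:R + 2 * k%:R :> R by rewrite natrD -muln2 natrM mulrC.
have -> : (n + k).+1%:R = n%:R + k%:R + 1 :> R by rewrite -natr1 natrD.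
have kb : (n%:R + 1) ^+ 2 <= k%:R :> R by rewrite natr1 -natrX ler_nat.
have k0' : (0 : R) <= k%:R by [].
have n0' : (0 : R) <= n%:R by [].
have sk : 0 <= sigma * k%:R by rewrite mulr_ge0// ltW.
have sn : 0 <= sigma * n%:R by rewrite mulr_ge0// ltW.
have ss : sigma * sigma <= sigma by rewrite ger_pMr// ltW.
by move: kb; rewrite expr2; lra.
Qed.

Lemma term_tail n K m : (0 < n)%N -> (K0 n <= K)%N ->
  \sum_(K <= k < K + m) T n k
    <= 4 * (K%:R * T n K - (K + m)%:R * T n (K + m)).
Proof.
move=> n0 K0K; elim: m => [|m IH]; first by rewrite addn0 big_geq// subrr mulr0.
rewrite addnS big_nat_recr ?leq_addr//=.
have := @term_telescope n (K + m) n0 (leq_trans K0K (leq_addr _ _)); lra.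
Qed.

(** The tail sums are dominated by a telescoping sum. *)
Lemma is_cvg_kernel n : (0 < n)%N -> cvgn (series (T n)).
Proof.
move=> n0; have T0 k : 0 <= T n k by rewrite ltW// T_gt0.
apply: nondecreasing_is_cvgn; first exact: series_nneg_nondecreasing.
exists (series (T n) (K0 n) + 4 * ((K0 n)%:R * T n (K0 n))) => _ [m _ <-].
apply: (@le_trans _ _ (series (T n) (K0 n + m)%N)).
  by apply: series_nneg_nondecreasing => //; exact: leq_addl.
rewrite -lerBlDl sub_series_geq ?leq_addr//; apply: le_trans (term_tail m n0 (leqnn _)) _.
by rewrite ler_pM2l// gerBl mulr_ge0.
Qed.

(** [k * T n k] is eventually nonincreasing, and cannot stay above a
    positive [e] since the terms would then dominate a multiple of the
    harmonic series. *)
Lemma term_cvg0 n : (0 < n)%N -> k%:R * T n k @[k --> \oo] --> 0.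
Proof.
move=> n0; have T0 k : 0 <= T n k by rewrite ltW// T_gt0.
have mono k m : (K0 n <= k)%N -> (k + m)%:R * T n (k + m) <= k%:R * T n k.
  move=> kk; have := term_tail m n0 kk.
  have : 0 <= \sum_(k <= i < k + m) T n i by rewrite sumr_ge0.
  by move=> ? ?; rewrite -subr_ge0; lra.
apply/cvgr0Pnorm_le => e e0.
have [[k [kk ke]]|H] := pselect (exists k, (K0 n <= k)%N /\ k%:R * T n k <= e).
  near=> m; have km : (k <= m)%N by near: m; exact: nbhs_infty_ge.
  rewrite ger0_norm; last exact: mulr_ge0.
  apply: le_trans ke.
  by rewrite -(subnKC km) mono.
exfalso; apply: (@dvg_harmonic R); apply: nondecreasing_is_cvgn.
  by apply: series_nneg_nondecreasing => k; exact: harmonic_ge0.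
have ca := is_cvg_kernel n0.
have tail N : series (fun k => T n k.+1) N <= kernel n.
  have -> : series (fun k => T n k.+1) N = series (T n) N.+1 - T n 0%N.
    by rewrite !series_ord big_ord_recl/= addrAC subrr add0r.
  rewrite lerBlDr; apply: (@le_trans _ _ (kernel n)); last by rewrite lerDl.
  by apply: nondecreasing_cvgn_le => //; exact: series_nneg_nondecreasing.
exists ((K0 n)%:R + kernel n / e) => _ [N _ <-].
have le1 k : harmonic k <= (k < K0 n)%:R + T n k.+1 / e :> R.
  have [kK|kK] := ltnP k (K0 n).
    rewrite (@le_trans _ _ 1) ?lerDl ?divr_ge0 ?(ltW e0)//.
    by rewrite /harmonic/= invf_le1 ?ltr0n// ler1n.
  rewrite add0r /harmonic/= -[_^-1]mul1r ler_pdivrMr ?ltr0n// mulrAC ler_pdivlMr// mul1r.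
  rewrite mulrC leNgt; apply/negP => h; apply: H; exists k.+1; split; last exact: ltW.
  by rewrite (leq_trans kK).
apply: (@le_trans _ _ (series (fun k => (k < K0 n)%:R + T n k.+1 / e) N)).
  by rewrite !series_ord; apply: ler_sum.
rewrite series_ord big_split/=; apply: lerD.
  rewrite -natr_sum ler_nat; have -> : (\sum_(i < N) (i < K0 n) = minn N (K0 n))%N.
    elim: N => [|N IH]; first by rewrite big_ord0 min0n.
    by rewrite big_ord_recr/= IH; lia.
  exact: geq_minr.
rewrite -mulr_suml ler_wpM2r ?invr_ge0 ?(ltW e0)//.
by rewrite -(series_ord (fun k => T n k.+1)) tail.
Unshelve. all: by end_near. Qed.

(** Zeilberger's telescoping: the combination
    [(n + 1 + sigma) T n.+1 k - (n - sigma) T n k] is the increment in [k] of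
    [- 2 k T n k]. *)
Lemma partial_sum_wz n K : (0 < n)%N ->
  (n%:R + 1 + sigma) * series (T n.+1) K - (n%:R - sigma) * series (T n) K
  = - 2 * (K%:R * T n K).
Proof.
move=> n0; elim: K => [|K IH]; first by rewrite !series_ord !big_ord0; ring.
rewrite !seriesSr !mulrDr opprD addrACA IH T_Sl// T_Sr//.
have d0 : (K.+1%:R : R) != 0 by rewrite pnatr_eq0.
have c0 : ((n + K).+1%:R : R) != 0 by rewrite pnatr_eq0.
have -> : (n + K.*2)%:R = n%:R + 2 * K%:R :> R by rewrite natrD -muln2 natrM mulrC.
move: d0 c0; rewrite -!natr1 natrD => d0 c0.
by field; rewrite c0 d0.
Qed.

(** The right-hand side of the preceding identity tends to [0]. *)
Lemma kernel_rec n : (0 < n)%N -> (n%:R + 1 + sigma) * kernel n.+1 = (n%:R - sigma) * kernel n.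
Proof.
move=> n0; apply/eqP; rewrite -subr_eq0; apply/eqP.
have L : (n%:R + 1 + sigma) * series (T n.+1) K - (n%:R - sigma) * series (T n) K
   @[K --> \oo] --> (n%:R + 1 + sigma) * kernel n.+1 - (n%:R - sigma) * kernel n.
  by apply: cvgB; (apply: cvgM; first exact: cvg_cst); exact: is_cvg_kernel.
have L0 : - 2 * (K%:R * T n K) @[K --> \oo] --> (- 2 * 0 : R).
  by apply: cvgM; [exact: cvg_cst | exact: term_cvg0].
rewrite mulr0 in L0; apply: (cvg_unique _ L _) => //.
rewrite (_ : (fun K => _) = (fun K => - 2 * (K%:R * T n K)))//.
by apply/funext => K; exact: partial_sum_wz.
Qed.

Lemma kernel_gt0 n : (0 < n)%N -> 0 < kernel n.
Proof.
move=> n0; apply: (@lt_le_trans _ _ (series (T n) 1%N)).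
  by rewrite series_ord big_ord1 T_gt0.
apply: nondecreasing_cvgn_le; last exact: is_cvg_kernel.
by apply: series_nneg_nondecreasing => k; rewrite ltW// T_gt0.
Qed.

Let p := 1 + 2 * sigma.

(** Bernoulli's inequality is Young's inequality for the product [y * 1]. *)
Lemma bernoulli_powR y : 0 <= y -> 1 + p * (y - 1) <= y `^ p.
Proof.
move=> y0; have p0 : 0 < p by rewrite /p addr_gt0// mulr_gt0.
have q0 : 0 < p / (2 * sigma) by rewrite divr_gt0// mulr_gt0.
have pq : p^-1 + (p / (2 * sigma))^-1 = 1.
  by rewrite invf_div /p; field; rewrite ?gt_eqF//.
have := conjugate_powR y0 ler01 p0 q0 pq; rewrite powR1 mulr1 mul1r.
rewrite -(ler_pM2l p0) mulrDr mulrCA mulfV ?gt_eqF// mulr1 invf_div mulrCA mulfV ?gt_eqF// /p; lra.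
Qed.

Lemma kernelS n : (0 < n)%N -> kernel n.+1 = (n%:R - sigma) / (n%:R + 1 + sigma) * kernel n.
Proof.
move=> n0; have xs0 : 0 < n%:R + 1 + sigma by rewrite !addr_gt0// ltr0n.
by apply: (mulfI (lt0r_neq0 xs0)); rewrite kernel_rec// mulrA mulrCA mulfV ?gt_eqF// mulr1.
Qed.

Lemma powR_ratio (a b : R) : 0 < a -> 0 < b -> (1 + p * (a / b - 1)) * b `^ p <= a `^ p.
Proof.
move=> a0 b0; have ab0 : 0 <= a / b by rewrite divr_ge0 ?ltW.
rewrite -[in leRHS](divfK (lt0r_neq0 b0) a) (powRM _ ab0 (ltW b0)).
by rewrite ler_wpM2r ?powR_ge0// bernoulli_powR.
Qed.

(** By Bernoulli, the ratio of consecutive values lies between those of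
    [(n - sigma)^-p] and [(n + sigma)^-p]. *)
Lemma kernel_upper n : (0 < n)%N -> kernel n * (n%:R + sigma) `^ p <= kernel 1 * (1 + sigma) `^ p.
Proof.
elim: n => // -[|n] IH _; first by [].
apply: le_trans (IH isT); set x := n.+1%:R; have x0 : 0 < x by rewrite ltr0n.
rewrite kernelS// mulrAC [leRHS]mulrC; apply: ler_wpM2r; first by rewrite ltW// kernel_gt0.
rewrite -[n.+2%:R]natr1 -/x; have xs : 0 < x + sigma by rewrite addr_gt0.
have x1 : 0 < x + 1 + sigma by rewrite !addr_gt0.
apply: le_trans (powR_ratio xs x1); apply: ler_wpM2r; first exact: powR_ge0.
by clearbody x; rewrite le_eqVlt; apply/orP; left; apply/eqP; rewrite /p; field; apply/eqP; lra.
Qed.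

Lemma kernel_lower n : (0 < n)%N -> kernel 1 * (1 - sigma) `^ p <= kernel n * (n%:R - sigma) `^ p.
Proof.
elim: n => // -[|n] IH _; first by [].
apply: le_trans (IH isT) _; set x := n.+1%:R; have x0 : 1 <= x by rewrite ler1n.
have xs : 0 < x - sigma by rewrite subr_gt0 (lt_le_trans sigma_lt1).
have x1 : 0 < x + 1 + sigma by rewrite !addr_gt0// (lt_le_trans ltr01).
rewrite (@kernelS n.+1 isT) mulrAC [leLHS]mulrC; apply: ler_wpM2r; first by rewrite ltW// kernel_gt0.
rewrite -[n.+2%:R]natr1 -/x mulrAC ler_pdivlMr// [leLHS]mulrC [leRHS]mulrC -ler_pdivrMr//.
have x2 : 0 < x + 1 - sigma by rewrite addrAC addr_gt0.
apply: le_trans (powR_ratio x2 xs).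
rewrite mulrAC; apply: ler_wpM2r; first exact: powR_ge0.
by clearbody x; rewrite le_eqVlt; apply/orP; left; apply/eqP; rewrite /p; field; apply/eqP; lra.
Qed.

Lemma kernel_bounds : exists c C, [/\ 0 < c, 0 < C &
  forall n, (0 < n)%N -> c * n%:R `^ (- p) <= kernel n <= C * n%:R `^ (- p)].
Proof.
have k1 := @kernel_gt0 1 isT.
exists (kernel 1 * (1 - sigma) `^ p), (kernel 1 * (1 + sigma) `^ p); split.
- by rewrite mulr_gt0 ?powR_gt0// subr_gt0.
- by rewrite mulr_gt0 ?powR_gt0// addr_gt0.
have p0 : 0 <= p by rewrite /p addr_ge0// mulr_ge0// ltW.
move=> n n0; have np : 0 < (n%:R : R) by rewrite ltr0n.
have n1 : 1 <= n%:R :> R by rewrite ler1n.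
have kn := ltW (kernel_gt0 n0).
rewrite powRN ler_pdivrMr ?powR_gt0// ler_pdivlMr ?powR_gt0//; apply/andP; split.
  apply: le_trans (kernel_lower n0) _; apply: ler_wpM2l => //.
  by apply: ge0_ler_powR => //; rewrite ?nnegrE ?subr_ge0 ?gerBl ?ler0n// ltW// (lt_le_trans sigma_lt1).
apply: le_trans (kernel_upper n0); apply: ler_wpM2l => //.
by apply: ge0_ler_powR => //; rewrite ?nnegrE ?addr_ge0 ?lerDl ?ler0n// ltW.
Qed.

End KernelSeries.

(** * The jump kernel of the fractional Laplacian *)
Section JumpKernel.
Context {R : realType}.
Variable sigma : R.
Hypothesis sigma01 : 0 < sigma < 1.
Implicit Types (n k : nat).

Let sigma_gt0 : 0 < sigma. Proof. by case/andP: sigma01. Qed.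
Let sigma_lt1 : sigma < 1. Proof. by case/andP: sigma01. Qed.

(** The integral of [exp (-2 t) t^(n + 2 k)] against [t^-(1 + sigma)], with its
    Bessel coefficient. *)
Definition kernel_term n k : R :=
  bessel_coeff n k * fine (mellin_exp 2 ((n + k.*2)%:R - sigma)).

Let arg_gt0 n k : (0 < n)%N -> 0 < (n + k.*2)%:R - sigma.
Proof.
move=> n0; rewrite subr_gt0 (lt_le_trans sigma_lt1)// ler1n.
by rewrite (leq_trans n0)// leq_addr.
Qed.

Lemma fine_mellin_expS s : 0 < s ->
  fine (mellin_exp 2 (s + 1)) = s / 2 * fine (mellin_exp (2 : R) s).
Proof.
move=> s0; have [c0 s1] : 0 < (2 : R) /\ 0 < s + 1 by split => //; rewrite addr_gt0.
move: (mellin_expS c0 s0) (mellin_exp_fin_num c0 s0) (mellin_exp_fin_num c0 s1).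
case: (mellin_exp 2 s) => [a||]//; case: (mellin_exp 2 (s + 1)) => [b||]// [H] _ _ /=.
by rewrite mulrAC H; field.
Qed.

Lemma kernel_term_gt0 n k : (0 < n)%N -> 0 < kernel_term n k.
Proof.
move=> n0; rewrite mulr_gt0 ?bessel_coeff_gt0// fine_gt0//.
rewrite mellin_exp_gt0 ?(ltW (arg_gt0 k n0))//=.
by rewrite ltey_eq mellin_exp_fin_num ?arg_gt0.
Qed.

Lemma kernel_term_Sl n k : (0 < n)%N ->
  kernel_term n.+1 k = ((n + k.*2)%:R - sigma) / (2 * (n + k).+1%:R) * kernel_term n k.
Proof.
move=> n0; rewrite /kernel_term /bessel_coeff !addSn.
have -> : (n + k.*2).+1%:R - sigma = (n + k.*2)%:R - sigma + 1 by rewrite -natr1; ring.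
move: ((n + k.*2)%:R - sigma) (arg_gt0 k n0) => s s0.
rewrite (fine_mellin_expS s0) factS natrM; move: (fine _) => M.
have a0 : (k`!%:R : R) != 0 by rewrite pnatr_eq0 -lt0n fact_gt0.
have b0 : ((n + k)`!%:R : R) != 0 by rewrite pnatr_eq0 -lt0n fact_gt0.
have c0 : ((n + k).+1%:R : R) != 0 by rewrite pnatr_eq0.
move: (k`!%:R : R) ((n + k)`!%:R : R) ((n + k).+1%:R : R) a0 b0 c0 => a b c a0 b0 c0.
by field; rewrite a0 b0 c0.
Qed.

Lemma kernel_term_Sr n k : (0 < n)%N ->
  kernel_term n k.+1 = ((n + k.*2)%:R - sigma) * ((n + k.*2)%:R + 1 - sigma)
    / (4 * k.+1%:R * (n + k).+1%:R) * kernel_term n k.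
Proof.
move=> n0; rewrite /kernel_term /bessel_coeff doubleS !addnS.
have -> : (n + k.*2)%:R + 1 - sigma = (n + k.*2)%:R - sigma + 1 by ring.
have -> : (n + k.*2).+2%:R - sigma = (n + k.*2)%:R - sigma + 1 + 1 by rewrite -!natr1; ring.
move: ((n + k.*2)%:R - sigma) (arg_gt0 k n0) => s s0.
rewrite (fine_mellin_expS (addr_gt0 s0 ltr01)) (fine_mellin_expS s0) !factS !natrM.
move: (fine _) => M.
have a0 : (k`!%:R : R) != 0 by rewrite pnatr_eq0 -lt0n fact_gt0.
have b0 : ((n + k)`!%:R : R) != 0 by rewrite pnatr_eq0 -lt0n fact_gt0.
have c0 : ((n + k).+1%:R : R) != 0 by rewrite pnatr_eq0.
have d0 : (k.+1%:R : R) != 0 by rewrite pnatr_eq0.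
move: (k`!%:R : R) ((n + k)`!%:R : R) ((n + k).+1%:R : R) (k.+1%:R : R) a0 b0 c0 d0
  => a b c d a0 b0 c0 d0.
by field; rewrite a0 b0 c0 d0.
Qed.

Lemma is_cvg_kernel_term n : (0 < n)%N -> cvgn (series (kernel_term n)).
Proof. exact: (is_cvg_kernel sigma01 kernel_term_gt0 kernel_term_Sr). Qed.

(** Termwise integration, by monotone convergence. *)
Lemma heat_integral x y (n := `|x - y|%N) : x != y ->
  \int[lebesgue_measure]_(t in `]0, +oo[) (heat t (\1_[set y]) x / t `^ (1 + sigma))
  = kernel kernel_term n.
Proof.
move=> xy; have n0 : (0 < n)%N by rewrite absz_gt0 subr_eq0.
pose v t k := bessel_coeff n k * (t `^ ((n + k.*2)%:R - sigma - 1) * expR (- (2 * t))) : R.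
have E t : 0 < t -> ((heat t (\1_[set y]) x / t `^ (1 + sigma))%:E = \sum_(k <oo) (v t k)%:E)%E.
  move=> t0; have [cv ->] := @heat_indicE R t x y (ltW t0); rewrite -/n in cv *.
  have sv : series (v t) = (fun K => expR (- (2 * t))
      * series (fun k => t ^+ (n + k.*2) * bessel_coeff n k) K / t `^ (1 + sigma)).
    apply/funext => K; rewrite !series_ord mulr_sumr mulr_suml; apply: eq_bigr => k _.
    rewrite /v (_ : _ - sigma - 1 = (n + k.*2)%:R - (1 + sigma)); last by ring.
    have tB : ((n + k.*2)%:R == 1 + sigma :> R) ==> (t != 0) by apply/implyP => _; rewrite gt_eqF.
    by rewrite (powRB tB) powR_mulrn 1?ltW//; ring.
  have L : series (v t) @ \oo --> expR (- (2 * t))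
      * limn (series (fun k => t ^+ (n + k.*2) * bessel_coeff n k)) / t `^ (1 + sigma).
    by rewrite sv; apply: cvgM; [apply: cvgM => // |]; exact: cvg_cst.
  rewrite nneseries_EFin; first by rewrite (cvg_lim _ L).
  by apply/cvg_ex; eexists; exact: L.
transitivity (fine (\int[lebesgue_measure]_(t in `]0%R, +oo[) \sum_(k <oo) (v t k)%:E)%E).
  by congr fine; apply: eq_integral => t; rewrite inE/= in_itv/= andbT => t0; exact: E.
rewrite integral_nneseries//; last 2 first.
- move=> k; apply/measurable_EFinP; apply: measurable_funM => //.
  exact: measurable_powR_expR.
- by move=> k t _; rewrite lee_fin mulr_ge0 ?(ltW (bessel_coeff_gt0 _ _))// mulr_ge0 ?powR_ge0 ?expR_ge0.
rewrite (eq_eseriesr (g := fun k => (kernel_term n k)%:E)).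
  by rewrite nneseries_EFin//; exact: is_cvg_kernel_term.
move=> k _; rewrite /v; under eq_integral do rewrite EFinM.
rewrite ge0_integralZl_EFin ?(ltW (bessel_coeff_gt0 _ _))//.
- by rewrite -/(mellin_exp _ _) /kernel_term EFinM fineK// mellin_exp_fin_num// arg_gt0.
- by move=> t _; rewrite lee_fin mulr_ge0 ?powR_ge0 ?expR_ge0.
- by apply/measurable_EFinP; exact: measurable_powR_expR.
Qed.

Lemma bsigmaE x y : bsigma sigma x y =
  if x == y then 0 else `|Gamma (- sigma)|^-1 * kernel kernel_term `|x - y|.
Proof. by rewrite /bsigma; case: eqP => // /eqP xy; rewrite heat_integral. Qed.

Lemma bsigma_bounds : exists c C, [/\ 0 < c, 0 < C & forall x y, x != y ->
  c * `|x - y|%:R `^ (- (1 + 2 * sigma)) <= bsigma sigma x y <= C * `|x - y|%:R `^ (- (1 + 2 * sigma))].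
Proof.
have [c [C [c0 C0 H]]] := kernel_bounds sigma01 kernel_term_gt0 kernel_term_Sl kernel_term_Sr.
have g0 : 0 < `|Gamma (- sigma)|^-1 by rewrite invr_gt0 normr_gt0 Gamma_neg_neq0.
exists (`|Gamma (- sigma)|^-1 * c), (`|Gamma (- sigma)|^-1 * C); split; rewrite ?mulr_gt0//.
move=> x y xy; rewrite bsigmaE (negbTE xy) -!mulrA !ler_pM2l//.
by apply: H; rewrite absz_gt0 subr_eq0.
Qed.

Lemma bsigma_sym x y : bsigma sigma x y = bsigma sigma y x.
Proof. by rewrite !bsigmaE eq_sym distnC. Qed.

End JumpKernel.

(** * Sums over the integers as series *)
Section SumsOverZ.
Context {R : realType}.
Implicit Types (f g : int -> R) (n : nat).

(** The order [0, -1, 1, -2, 2, ...]: partial sums exhaust symmetric windows. *)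
Definition enumZ n : int := if odd n then Negz n./2 else Posz n./2.

Lemma enumZ_bij : bijective enumZ.
Proof.
exists (fun z => match z with Posz n => n.*2 | Negz n => n.*2.+1 end) => [n|[] n].
- rewrite /enumZ; case: ifP => o /=; rewrite -[RHS]odd_double_half o //.
- by rewrite /enumZ odd_double doubleK.
- by rewrite /enumZ /= odd_double/= uphalf_double.
Qed.

Lemma esum_enumZ (F : int -> \bar R) : (forall y, 0 <= F y)%E ->
  (\esum_(y in [set: int]) F y = \sum_(k <oo) F (enumZ k))%E.
Proof.
move=> F0; rewrite (reindex_esum [set: nat] _ enumZ)//; last first.
  by rewrite setTT_bijective; exact: enumZ_bij.
by rewrite nneseries_esumT.
Qed.

Lemma esum_ltyP f : (forall y, 0 <= f y) ->
  (\esum_(y in [set: int]) (f y)%:E < +oo)%E <-> cvgn (series (f \o enumZ)).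
Proof.
move=> f0; rewrite esum_enumZ; last by move=> y; rewrite lee_fin.
split=> [/nnseries_is_cvg|cf]; first by apply => k; exact: f0.
by rewrite (nneseries_EFin cf) ltry.
Qed.

Lemma sumZ_cvg f : cvgn (series (fun k => `|f (enumZ k)|)) ->
  series (f \o enumZ) @ \oo --> sumZ f.
Proof.
move=> cf; have cf' : cvgn (series (f \o enumZ)) by exact: normed_cvg.
suff -> : sumZ f = limn (series (f \o enumZ)) by [].
have sf : summable [set: nat] (EFin \o f \o enumZ).
  rewrite /summable -nneseries_esumT//.
  by rewrite (nneseries_EFin cf) ltry.
rewrite /sumZ !(reindex_esum [set: nat] [set: int] enumZ)//;
  try by rewrite setTT_bijective; exact: enumZ_bij.
have := @summable_eseries_esum R (EFin \o f \o enumZ) xpredT.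
rewrite (_ : (fun=> is_true true) = [set: nat]); last by apply/seteqP; split.
move=> /(_ sf) H; transitivity (fine (\sum_(i <oo) (f (enumZ i))%:E)%E).
  congr fine; rewrite [RHS]H.
  by congr (_ - _)%E; apply: eq_esum => i _; rewrite ?funeposE ?funenegE.
by rewrite (nneseries_EFin cf').
Qed.

(** At most two integers lie at each distance from [x]. *)
Lemma sum_dist_le (s : seq int) (x : int) (h : nat -> R) (B : R) : uniq s ->
  (forall k, 0 <= h k) -> (forall K, \sum_(k < K) h k <= B) ->
  \sum_(y <- s) h `|x - y|%N <= 2 * B.
Proof.
move=> us h0 hB; pose K := (\max_(y <- s) `|x - y|%N).+1.
have sK y : y \in s -> (`|x - y| < K)%N by move=> ys; rewrite ltnS; apply: leq_bigmax_seq.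
apply: le_trans (ler_wpM2l (ler0n _ 2) (hB K)).
have -> : \sum_(y <- s) h `|x - y|%N =
    \sum_(y <- s) \sum_(k < K | k == `|x - y|%N :> nat) h k.
  rewrite big_seq [RHS]big_seq; apply: eq_bigr => y ys.
  by rewrite (big_pred1 (Ordinal (sK _ ys)))// => k; rewrite -val_eqE.
rewrite (exchange_big_dep xpredT)//= mulr_sumr; apply: ler_sum => k _.
rewrite -big_filter big_const_seq count_predT iter_addr_0.
rewrite -[leLHS]mulr_natl ler_wpM2r// ler_nat -[2%N]/(size [:: x - k%:Z; x + k%:Z]).
apply: uniq_leq_size; first exact: filter_uniq.
by move=> y; rewrite mem_filter => /andP[/eqP ky _]; rewrite !inE; lia.
Qed.

Lemma series_enumZ_le x (h : nat -> R) (B : R) N :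
  (forall k, 0 <= h k) -> (forall K, \sum_(k < K) h k <= B) ->
  \sum_(i < N) h `|x - enumZ i|%N <= 2 * B.
Proof.
move=> h0 hB; rewrite -(big_mkord xpredT (fun i => h `|x - enumZ i|%N)).
rewrite -(big_map enumZ xpredT (fun y => h `|x - y|%N)); apply: sum_dist_le => //.
by rewrite map_inj_uniq ?iota_uniq//; exact: bij_inj enumZ_bij.
Qed.

End SumsOverZ.

(** * Elementary estimates *)
Section ElementarySums.
Context {R : realType}.
Implicit Types (a r s x y : R) (k n m : nat).

Lemma powRD_gt0 x r s : 0 < x -> x `^ (r + s) = x `^ r * x `^ s.
Proof. by move=> x0; apply: powRD; apply/implyP => _; rewrite gt_eqF. Qed.

Lemma ln_le_subr1 a : 0 < a -> ln a <= a - 1.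
Proof. by move=> a0; rewrite -{1}(subrKC 1 a) le_ln1Dx// ltrBrDl subrr. Qed.

Lemma powRN_ge a s : 0 < a -> 0 <= s -> 1 + s * (1 - a) <= a `^ (- s).
Proof.
move=> a0 s0; rewrite /powR gt_eqF//; apply: le_trans (expR_ge1Dx _).
by rewrite lerD2l mulNr -mulrN ler_wpM2l// lerNr opprB ln_le_subr1.
Qed.

Lemma sum_inv_le_ln m : (0 < m)%N -> \sum_(k < m) (k.+1%:R : R)^-1 <= 1 + ln (m%:R : R).
Proof.
elim: m => // -[|m] IH _; first by rewrite big_ord_recl big_ord0 invr1 addr0 ln1 addr0.
rewrite big_ord_recr/=; have x0 : (0 : R) < m.+1%:R by rewrite ltr0n.
have y0 : (0 : R) < m.+2%:R by rewrite ltr0n.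
have := ln_le_subr1 (divr_gt0 x0 y0); rewrite ln_div ?posrE//.
have -> : m.+1%:R / m.+2%:R - 1 = - (m.+2%:R : R)^-1.
  by rewrite -(natr1 m.+1); move: (m.+1%:R : R) x0 => z z0; field; apply/eqP; lra.
move=> ?; rewrite -lerBrDr; apply: le_trans (IH isT) _.
by rewrite -addrA lerD2l [leRHS]addrC -lerBlDr.
Qed.

(** The kernel [k^-(1 + s)], damped quadratically below the scale [n]; the value
    at [k = 0] is set to [0] because a point does not jump to itself. *)
Definition truncated_tail s n k : R := if k == 0 :> nat then 0 else
  k%:R `^ (- (1 + s)) * Num.min 1 ((k%:R / n%:R) ^+ 2).

Lemma truncated_tail_ge0 s n k : 0 <= truncated_tail s n k.
Proof.
by rewrite /truncated_tail; case: eqP => // _; rewrite mulr_ge0 ?powR_ge0// le_min ler01 sqr_ge0.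
Qed.

(** The sum of [k^-(1+s)] over [k > n] and that of [k^(1-s) / n^2] over
    [k <= n] are both of order [n^-s]. *)
Lemma sum_truncated_tail s n m : 0 < s -> s <= 1 -> (0 < n)%N ->
  \sum_(k < m) truncated_tail s n k <= (1 + s^-1) * n%:R `^ (- s).
Proof.
move=> s0 s1 n0; pose h := truncated_tail s n; rewrite -/h.
have n0' : (0 : R) < n%:R by rewrite ltr0n.
have h0 k : 0 <= h k by exact: truncated_tail_ge0.
have step k : (0 < k)%N -> h k.+1 <= s^-1 * (k%:R `^ (- s) - k.+1%:R `^ (- s)).
  move=> k0; have k0' : (0 : R) < k%:R by rewrite ltr0n.
  have k1 : (0 : R) < k.+1%:R by rewrite ltr0n.
  rewrite /h /truncated_tail/=; apply: (@le_trans _ _ (k.+1%:R `^ (- (1 + s)))).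
    by rewrite ler_piMr ?powR_ge0// ge_min lexx.
  rewrite ler_pdivlMl//.
  have -> : (k%:R : R) `^ (- s) = (k%:R / k.+1%:R) `^ (- s) * k.+1%:R `^ (- s).
    by rewrite -powRM ?divr_ge0// divfK// gt_eqF.
  have : (1 + s * (1 - k%:R / k.+1%:R)) * k.+1%:R `^ (- s)
      <= (k%:R / k.+1%:R) `^ (- s) * k.+1%:R `^ (- s).
    by rewrite ler_wpM2r ?powR_ge0// powRN_ge ?divr_gt0// ltW.
  have -> : (k.+1%:R : R) `^ (- (1 + s)) = k.+1%:R^-1 * k.+1%:R `^ (- s).
    by rewrite (_ : - (1 + s) = -1 - s) ?powRD_gt0 ?powR_inv1 ?ler0n//; ring.
  have -> : 1 - k%:R / k.+1%:R = (k.+1%:R : R)^-1.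
    by rewrite -(natr1 k); move: (k%:R : R) k0' => z z0; field; apply/eqP; lra.
  move: (k.+1%:R^-1 : R) ((k%:R / k.+1%:R) `^ (- s)) (k.+1%:R `^ (- s)) => z q w; lra.
(* Below the scale [n] each term is at most [n^-(1 + s)]. *)
have low k : (k <= n)%N -> \sum_(i < k.+1) h i <= k%:R * n%:R `^ (- (1 + s)).
  elim: k => [|k IH] kn; first by rewrite big_ord1 /h /truncated_tail/= mul0r.
  rewrite big_ord_recr/= -[k.+1%:R]natr1 mulrDl mul1r; apply: lerD; first by rewrite IH// ltnW.
  have k1 : (0 : R) < k.+1%:R by rewrite ltr0n.
  rewrite /h /truncated_tail/=.
  apply: (@le_trans _ _ (k.+1%:R `^ (- (1 + s)) * (k.+1%:R / n%:R) ^+ 2)).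
    by rewrite ler_wpM2l ?powR_ge0// ge_min lexx orbT.
  have E (z : R) : 0 < z -> z `^ (- (1 + s)) * z ^+ 2 = z `^ (1 - s).
    move=> z0; rewrite -powR_mulrn ?(ltW z0)// -powRD_gt0//; congr (_ `^ _); ring.
  rewrite exprMn mulrA E// exprVn ler_pdivrMr ?exprn_gt0// E//.
  by apply: ge0_ler_powR; rewrite ?nnegrE ?subr_ge0// ler_nat.
have nE : n%:R * n%:R `^ (- (1 + s)) = n%:R `^ (- s) :> R.
  by rewrite -{1}(powRr1 (ltW n0')) -powRD_gt0//; congr (_ `^ _); ring.
(* Beyond [n] the terms are dominated by a telescoping sum. *)
have high k : \sum_(i < (n + k).+1) h i
    <= n%:R `^ (- s) + s^-1 * (n%:R `^ (- s) - (n + k)%:R `^ (- s)).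
  elim: k => [|k IH]; first by rewrite addn0 subrr mulr0 addr0 -nE low.
  rewrite addnS big_ord_recr/=; have := @step (n + k)%N; rewrite addn_gt0 n0 => /(_ isT).
  by move=> ?; rewrite -lerBrDr; apply: le_trans IH _; lra.
apply: (@le_trans _ _ (\sum_(i < (n + m).+1) h i)).
  rewrite -!(big_mkord xpredT h) (@big_cat_nat _ _ _ m 0 (n + m).+1)//=; last by rewrite leqW// leq_addl.
  by rewrite lerDl sumr_ge0.
apply: le_trans (high m) _; rewrite mulrDl mul1r lerD2l ler_wpM2l ?invr_ge0 ?(ltW s0)//.
by rewrite gerBl powR_ge0.
Qed.

(** For [r] near [1] use [ln r <= r - 1]; for [r] large, [ln r] is at most a
    multiple of [r^(al / 2)]. *)
Lemma powRN_ln2_le al r : 0 < al -> 1 <= r ->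
  r `^ (- al) * ln r ^+ 2 <= (1 + 4 / al ^+ 2) * Num.min 1 ((r - 1) ^+ 2).
Proof.
move=> al0 r1; have r0 : 0 < r by exact: lt_le_trans r1.
have l0 := ln_ge0 r1; have A0 : 0 < al ^+ 2 by rewrite exprn_gt0.
have d0 : 0 <= 4 / al ^+ 2 by rewrite divr_ge0// ltW.
have P := powR_gt0 al r0; have P1 : 1 <= r `^ al by rewrite -[1](powRr0 r) ler_powR// ltW.
rewrite powRN mulrC ler_pdivrMr//; have [_|_] := lerP 1 ((r - 1) ^+ 2).
  rewrite mulr1.
  have h : ln r <= 2 / al * r `^ (al / 2).
    have := ltW (ln_sublinear (powR_gt0 (al / 2) r0)); rewrite ln_powR.
    by rewrite -ler_pdivlMl ?divr_gt0// invf_div.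
  have h2 : ln r ^+ 2 <= (2 / al * r `^ (al / 2)) ^+ 2 by rewrite lerXn2r// nnegrE// (le_trans l0).
  have E : (r `^ (al / 2)) ^+ 2 = r `^ al by rewrite -powR_mulrn ?powR_ge0// -powRrM divfK.
  apply: le_trans h2 _; rewrite exprMn E.
  by rewrite ler_pM2r// expr_div_n -natrX lerDr.
have h : ln r <= r - 1 by exact: ln_le_subr1.
have h2 : ln r ^+ 2 <= (r - 1) ^+ 2 by rewrite lerXn2r// nnegrE// (le_trans l0).
apply: le_trans h2 _; rewrite mulrAC ler_peMl ?sqr_ge0//.
by rewrite mulr_ege1// lerDl.
Qed.

End ElementarySums.

(** * Comparison of ground state energies *)
Section EnergyComparison.
Context {R : realType}.
Implicit Types (b : nat -> nat -> R) (u w phi D : nat -> R) (N : nat).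

Lemma sum2_sym N b (g : nat -> nat -> R) : (forall i j, b i j = b j i) ->
  \sum_(i < N) \sum_(j < N) b i j * (g i j + g j i) = 2 * \sum_(i < N) \sum_(j < N) b i j * g i j.
Proof.
move=> bC; under eq_bigr do under eq_bigr do rewrite mulrDr.
under eq_bigr do rewrite big_split/=.
rewrite big_split/= [X in _ + X]exchange_big/=.
under [X in _ + X]eq_bigr do under eq_bigr do rewrite bC.
by rewrite mulr_natl mulr2n.
Qed.

(** Both sides are ground state representations of twice the quadratic form
    of the operator at [f = u phi], over a finite window: the left one with
    respect to the supersolution [w], the right one with respect to [u], whose
    defect of harmonicity on the window is the last term. *)
Lemma energy_comparison N b u w phi D :
  (forall i j, b i j = b j i) -> (forall i, 0 < w i) ->
  (forall i, \sum_(j < N) b i j * w j <= D i * w i) ->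
  \sum_(i < N) \sum_(j < N) b i j * (w i * w j * (u i * phi i / w i - u j * phi j / w j) ^+ 2)
  <= \sum_(i < N) \sum_(j < N) b i j * (u i * u j * (phi i - phi j) ^+ 2)
     + 2 * \sum_(i < N) phi i ^+ 2 * u i * (D i * u i - \sum_(j < N) b i j * u j).
Proof.
move=> bC w0 super.
pose B := \sum_(i < N) \sum_(j < N) b i j * (u i * phi i * (u j * phi j)).
have LE : \sum_(i < N) \sum_(j < N) b i j * (w i * w j * (u i * phi i / w i - u j * phi j / w j) ^+ 2)
   = 2 * (\sum_(i < N) (u i * phi i) ^+ 2 / w i * \sum_(j < N) b i j * w j - B).
  pose g i j := (u i * phi i) ^+ 2 / w i * w j - u i * phi i * (u j * phi j).
  transitivity (\sum_(i < N) \sum_(j < N) b i j * (g i j + g j i)).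
    apply: eq_bigr => i _; apply: eq_bigr => j _; congr (_ * _).
    by rewrite /g; field; rewrite !gt_eqF ?w0.
  rewrite sum2_sym// /B -sumrB; congr (2 * _); apply: eq_bigr => i _.
  rewrite mulr_sumr -sumrB; apply: eq_bigr => j _; rewrite /g; ring.
have RE : \sum_(i < N) \sum_(j < N) b i j * (u i * u j * (phi i - phi j) ^+ 2)
   = 2 * (\sum_(i < N) phi i ^+ 2 * u i * \sum_(j < N) b i j * u j - B).
  pose g i j := phi i ^+ 2 * u i * u j - u i * phi i * (u j * phi j).
  transitivity (\sum_(i < N) \sum_(j < N) b i j * (g i j + g j i)).
    by apply: eq_bigr => i _; apply: eq_bigr => j _; congr (_ * _); rewrite /g; ring.
  rewrite sum2_sym// /B -sumrB; congr (2 * _); apply: eq_bigr => i _.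
  rewrite mulr_sumr -sumrB; apply: eq_bigr => j _; rewrite /g; ring.
rewrite LE RE -mulrDr ler_pM2l// -addrAC lerD2r -big_split/=.
apply: ler_sum => i _; rewrite -mulrDr subrKC.
have -> : phi i ^+ 2 * u i * (D i * u i) = (u i * phi i) ^+ 2 / w i * (D i * w i).
  by field; rewrite gt_eqF ?w0.
by apply: ler_wpM2l => //; rewrite divr_ge0 ?sqr_ge0 ?(ltW (w0 i)).
Qed.

End EnergyComparison.

(** * Energy of the logarithmic cutoffs *)

Lemma absz_sub_le (x y : int) : (`|y|.+1 - `|x|.+1 <= `|x - y|)%N.
Proof. lia. Qed.

Section CutoffEnergy.
Context {R : realType}.
Variables (sigma : R) (b : int -> int -> R) (C : R).
Hypotheses (sigma_gt0 : 0 < sigma) (sigma_lt_half : sigma < 1 / 2).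
Hypotheses (C_ge0 : 0 <= C) (b0 : forall x, b x x = 0).
Hypothesis b_le : forall x y, x != y -> b x y <= C * `|x - y|%N%:R `^ (- (1 + 2 * sigma)).
Hypothesis b_ge0 : forall x y, 0 <= b x y.
Hypothesis b_sym : forall x y, b x y = b y x.
Implicit Types (x y : int) (n N : nat).

Let al := (1 - 2 * sigma) / 2.
Let al_gt0 : 0 < al. Proof. by move: sigma_lt_half; rewrite /al; lra. Qed.

(** [1 + |x|] rather than [|x|], so that powers and logarithms behave at [0]. *)
Definition weight x : R := `|x|%N.+1%:R.

Definition cutoff n x : R := Num.max 0 (1 - ln (weight x) / ln n%:R).

Lemma weight_ge1 x : 1 <= weight x. Proof. by rewrite /weight ler1n. Qed.

Lemma weight_gt0 x : 0 < weight x. Proof. by rewrite /weight ltr0n. Qed.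

Lemma cutoff_eq0 n x : (2 <= n)%N -> (n <= `|x|.+1)%N -> cutoff n x = 0.
Proof.
move=> n2 nx; have n1 : (1 : R) < n%:R by rewrite ltr1n.
rewrite /cutoff; apply/max_idPl; rewrite subr_le0 ler_pdivlMr ?ln_gt0// mul1r.
by rewrite ler_ln ?posrE ?weight_gt0 ?(lt_trans ltr01)// ler_nat.
Qed.

(** Taking the positive part does not increase differences. *)
Lemma cutoff_dist n x y : (2 <= n)%N ->
  (cutoff n x - cutoff n y) ^+ 2 <= (ln (weight y / weight x) / ln n%:R) ^+ 2.
Proof.
move=> n2; have n1 : (1 : R) < n%:R by rewrite ltr1n.
have l0 := ln_gt0 n1.
rewrite -real_normK ?num_real// -[leRHS]real_normK ?num_real// lerXn2r ?nnegrE//.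
rewrite ln_div ?posrE ?weight_gt0// mulrBl /cutoff.
move: (ln (weight x) / ln n%:R) (ln (weight y) / ln n%:R) => s t.
have := ler_norm (t - s); have := ler_norm (s - t); have := normr_ge0 (t - s).
rewrite (distrC s t) ler_norml; move: `|t - s| => d d0 sd td.
by rewrite /Num.max; do 2 case: ltP => ?; apply/andP; split; lra.
Qed.

Lemma ln_dvg (M : R) : \forall n \near \oo, M <= ln (n%:R : R).
Proof.
near=> n; rewrite -ler_expR lnK ?posrE; last by rewrite ltr0n; near: n; exact: nbhs_infty_gt.
by near: n; exact: nbhs_infty_ger.
Unshelve. all: by end_near. Qed.

Lemma cutoff_cvg x : cutoff n x @[n --> \oo] --> (1 : R).
Proof.
have c0 := ln_ge0 (weight_ge1 x).
apply/cvgrPdist_le => e e0; near=> n.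
have l1 : 1 <= ln (n%:R : R) by near: n; exact: ln_dvg.
have l2 : ln (weight x) / e <= ln (n%:R : R) by near: n; exact: ln_dvg.
have l0 := lt_le_trans ltr01 l1.
have ce : ln (weight x) / ln n%:R <= e by rewrite ler_pdivrMr// mulrC -ler_pdivrMr.
have : 0 <= ln (weight x) / ln n%:R by rewrite divr_ge0// ltW.
rewrite /cutoff; move: (_ / _) ce => s ce s0; rewrite /Num.max.
by case: ltP => ?; rewrite ger0_norm; lra.
Unshelve. all: by end_near. Qed.

Let A := 1 + 4 / al ^+ 2.

(** Bound for the energy carried by the pair [(x, y)] when [|x| <= |y|], in a
    form that depends on [y] only through [|x - y|]. *)
Let major n x y : R := if (`|x|.+1 < n)%N then
   C * A / ln n%:R ^+ 2 * weight x `^ (- (2 * al)) * truncated_tail (2 * sigma) `|x|.+1 `|x - y|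
  else 0.

Let jump n x y := b x y * (weight x `^ (- al) * weight y `^ (- al) * (cutoff n x - cutoff n y) ^+ 2).

Let major_ge0 n x y : 0 <= major n x y.
Proof.
rewrite /major; case: ifP => // _.
by rewrite !mulr_ge0 ?powR_ge0 ?truncated_tail_ge0 ?invr_ge0 ?sqr_ge0// /A addr_ge0 ?divr_ge0 ?sqr_ge0.
Qed.

Let jump_le n x y : (2 <= n)%N -> (`|x| <= `|y|)%N -> jump n x y <= major n x y.
Proof.
move=> n2 xy; have [->|neq] := eqVneq x y; first by rewrite /jump b0 mul0r.
rewrite /major; case: ltnP => [xn|nx]; last first.
  rewrite /jump !cutoff_eq0// ?subrr ?expr0n ?mulr0//.
  by rewrite (leq_trans nx).
have wx := weight_gt0 x; have wy := weight_gt0 y.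
have n1 : (1 : R) < n%:R by rewrite ltr1n.
have l0 : 0 < ln n%:R ^+ 2 :> R by rewrite exprn_gt0// ln_gt0.
set r := weight y / weight x.
have r1 : 1 <= r by rewrite ler_pdivlMr// mul1r ler_nat.
have wyE : weight y `^ (- al) = r `^ (- al) * weight x `^ (- al).
  by rewrite -powRM ?divfK ?gt_eqF// ltW// (lt_le_trans ltr01).
have k0 : (0 < `|x - y|)%N by rewrite absz_gt0 subr_eq0.
rewrite /truncated_tail ifF; last by rewrite gtn_eqF.
have step1 : jump n x y <= C * `|x - y|%N%:R `^ (- (1 + 2 * sigma)) *
    (weight x `^ (- al) * weight y `^ (- al) * (ln r / ln n%:R) ^+ 2).
  rewrite /jump; apply: ler_pM => //.
  - by apply: mulr_ge0; [rewrite mulr_ge0 ?powR_ge0 | exact: sqr_ge0].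
  - exact: b_le.
  - by apply: ler_wpM2l; [rewrite mulr_ge0 ?powR_ge0 | exact: cutoff_dist].
apply: le_trans step1 _.
have step2 := powRN_ln2_le al_gt0 r1.
have step3 : Num.min 1 ((r - 1) ^+ 2) <= Num.min 1 ((`|x - y|%N%:R / `|x|.+1%:R) ^+ 2).
  rewrite le_min ge_min lexx/= ge_min; apply/orP; right.
  rewrite lerXn2r ?nnegrE ?subr_ge0 ?divr_ge0//.
  rewrite ler_pdivlMr// -/(weight x) mulrBl mul1r divfK ?gt_eqF// /weight.
  have yx := absz_sub_le x y.
  by rewrite -natrB ?ltnS// ler_nat.
have -> : weight x `^ (- (2 * al)) = weight x `^ (- al) * weight x `^ (- al).
  by rewrite -powRD_gt0//; congr (_ `^ _); ring.
rewrite wyE expr_div_n.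
set P := _ `^ (- (1 + 2 * sigma)); set Q := weight x `^ (- al).
have -> : C * P * (Q * (r `^ (- al) * Q) * (ln r ^+ 2 / ln n%:R ^+ 2))
   = C * P * Q * Q / ln n%:R ^+ 2 * (r `^ (- al) * ln r ^+ 2) by ring.
have -> : C * A / ln n%:R ^+ 2 * (Q * Q) * (P * Num.min 1 ((`|x - y|%:R / `|x|.+1%:R) ^+ 2))
   = C * P * Q * Q / ln n%:R ^+ 2 * (A * Num.min 1 ((`|x - y|%:R / `|x|.+1%:R) ^+ 2)) by ring.
apply: ler_wpM2l; first by rewrite !mulr_ge0 ?invr_ge0 ?powR_ge0 ?sqr_ge0.
apply: le_trans step2 _; apply: ler_wpM2l => //.
by rewrite addr_ge0// divr_ge0// sqr_ge0.
Qed.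

(** By symmetry each pair is charged to its point nearer to the origin. Then
    [sum_truncated_tail] sums over [y], giving [1 / weight x] up to the factor
    [1 / ln n ^ 2], and the sum over [x] is a harmonic sum. *)
Lemma cutoff_energy_le : exists K, forall n N, (2 <= n)%N ->
  \sum_(i < N) \sum_(j < N) b (enumZ i) (enumZ j) *
    (weight (enumZ i) `^ (- ((1 - 2 * sigma) / 2)) * weight (enumZ j) `^ (- ((1 - 2 * sigma) / 2))
      * (cutoff n (enumZ i) - cutoff n (enumZ j)) ^+ 2)
  <= K * ((1 + ln n%:R) / ln n%:R ^+ 2).
Proof.
pose B := 1 + (2 * sigma)^-1.
exists (2 * (C * A * (2 * B) * 2)) => n N n2.
have n1 : (1 : R) < n%:R by rewrite ltr1n.
have l0 : 0 < ln n%:R ^+ 2 :> R by rewrite exprn_gt0// ln_gt0.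
have A0 : 0 <= A by rewrite addr_ge0// divr_ge0// sqr_ge0.
have s0 : 0 < 2 * sigma by rewrite mulr_gt0.
have B0 : 0 <= B by rewrite addr_ge0// invr_ge0 ltW.
have jumpC x y : jump n x y = jump n y x by rewrite /jump b_sym; ring.
rewrite -/al; apply: (@le_trans _ _ (\sum_(i < N) \sum_(j < N)
    (1 * (major n (enumZ i) (enumZ j) + major n (enumZ j) (enumZ i))))).
  apply: ler_sum => i _; apply: ler_sum => j _; rewrite mul1r.
  have [ij|ji] := leqP `|enumZ i| `|enumZ j|.
    by apply: le_trans (jump_le n2 ij) _; rewrite lerDl.
  by rewrite -/(jump n _ _) jumpC; apply: le_trans (jump_le n2 (ltnW ji)) _; rewrite lerDr.
rewrite (@sum2_sym _ _ (fun _ _ => 1) (fun i j => major n (enumZ i) (enumZ j)))// -mulrA ler_pM2l//.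
pose h k : R := if (k.+1 < n)%N then k.+1%:R^-1 else 0.
have row x : \sum_(j < N) major n x (enumZ j) <= C * A * (2 * B) / ln n%:R ^+ 2 * h `|0 - x|%N.
  rewrite sub0r abszN /major /h; case: ifP => _; last by rewrite big1// mulr0.
  have s1 : 2 * sigma <= 1 by move: sigma_lt_half; lra.
  have row := @series_enumZ_le R x (truncated_tail (2 * sigma) `|x|.+1) _ N
    (truncated_tail_ge0 _ _) (fun K => @sum_truncated_tail R (2 * sigma) `|x|.+1 K s0 s1 isT).
  have c0 : 0 <= C * A / ln n%:R ^+ 2 * weight x `^ (- (2 * al)).
    by rewrite mulr_ge0 ?powR_ge0// divr_ge0 ?(ltW l0)// mulr_ge0.
  rewrite -mulr_sumr; apply: le_trans (ler_wpM2l c0 row) _.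
  have -> : (`|x|.+1%:R : R)^-1 = weight x `^ (- (2 * al)) * weight x `^ (- (2 * sigma)).
    rewrite -powRD_gt0 ?weight_gt0// -powR_inv1 ?ler0n//; congr (_ `^ _).
    by rewrite /al; field.
  by rewrite /weight -/B le_eqVlt; apply/orP; left; apply/eqP; ring.
apply: (@le_trans _ _ (\sum_(i < N) C * A * (2 * B) / ln n%:R ^+ 2 * h `|0 - enumZ i|%N)).
  rewrite (_ : \sum_(i < N) _ = \sum_(i < N) \sum_(j < N) major n (enumZ i) (enumZ j)); last first.
    by apply: eq_bigr => i _; apply: eq_bigr => j _; rewrite mul1r.
  by apply: ler_sum.
have hle : \sum_(i < N) h `|0 - enumZ i|%N <= 2 * (1 + ln n%:R).
  apply: series_enumZ_le => [k|K].
    by rewrite /h; case: ifP => // _; rewrite invr_ge0.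
  apply: le_trans (sum_inv_le_ln (ltnW n2)).
  rewrite (big_ord_widen (n + K) (fun k => k.+1%:R^-1 : R))%N ?leq_addr//.
  rewrite (big_ord_widen (n + K) h) ?leq_addl// big_mkcond [leRHS]big_mkcond.
  apply: ler_sum => k _; rewrite /h.
  have inv0 : 0 <= (k.+1%:R : R)^-1 by rewrite invr_ge0.
  case: (ltnP k K) => _; last by case: ifP.
  by case: (ltnP k.+1 n) => [/ltnW ->//|_]; case: ifP.
rewrite -mulr_sumr; apply: le_trans (ler_wpM2l _ hle) _.
  by rewrite divr_ge0 ?(ltW l0)// !mulr_ge0.
by rewrite le_eqVlt; apply/orP; left; apply/eqP; ring.
Qed.

End CutoffEnergy.

(** * Asymptotic conditions at infinity *)
Section Asymptotics.
Context {R : realType}.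
Implicit Types (u f : int -> R).

Lemma enumZ_far n i : (n.*2 <= i)%N -> (n <= `|enumZ i|.+1)%N.
Proof.
rewrite /enumZ; case: ifP => _; rewrite ?NegzE ?abszN => ni; lia.
Qed.

(** The bound holds outside a finite set by assumption, and on a finite set
    after enlarging the constant. *)
Lemma bigO_weight u al : 0 < al -> bigO_Z u (fun x => absZ R x `^ (- al)) ->
  exists C, forall x, `|u x| <= C * weight x `^ (- al).
Proof.
move=> al0 /ereal_inf_lt[_ [A fA <-] supA].
have [M M0 HM] : exists2 M : R, 0 <= M & forall x, A x -> `|u x| / `|absZ R x `^ (- al)| <= M.
  move: supA; set S := ereal_sup _ => SA.
  have leS x : A x -> ((`|u x| / `|absZ R x `^ (- al)|)%:E <= S)%E.
    by move=> Ax; apply: ereal_sup_ubound; exists x.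
  case: S SA leS => [r _ leS|//|_ leS]; last by exists 0 => // x /leS; rewrite leeNy_eq.
  exists (Num.max 0 r); first by rewrite le_max lexx.
  by move=> x /leS; rewrite lee_fin le_max => ->; rewrite orbT.
have [F FE] : exists F : seq int, ~` A `|` [set 0] = [set` F].
  by apply/finite_seqP; rewrite finite_setU; split => //; exact: finite_set1.
exists (M * 2 `^ al + \sum_(y <- F) `|u y| * weight y `^ al) => x.
rewrite powRN ler_pdivlMr ?powR_gt0 ?weight_gt0//.
have S0 (G : seq int) : 0 <= \sum_(y <- G) `|u y| * weight y `^ al.
  by rewrite sumr_ge0// => y _; rewrite mulr_ge0 ?powR_ge0.
have [xF|xF] := boolP (x \in F).
  by rewrite ler_wpDl ?mulr_ge0 ?powR_ge0// (big_rem x)//= lerDl.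
rewrite ler_wpDr//.
have [Ax x0] : A x /\ x != 0.
  have : ~ (~` A `|` [set 0]) x by rewrite FE /=; exact/negP.
  by move=> /not_orP[/contrapT Ax /eqP x0].
have ax0 : (0 < `|x|)%N by rewrite absz_gt0.
have axE : absZ R x = `|x|%N%:R by rewrite /absZ natr_absz intr_norm.
have := HM x Ax; rewrite axE (ger0_norm (powR_ge0 _ _)) powRN invrK => h.
apply: le_trans (_ : _ <= `|u x| * (`|x|%N%:R `^ al * 2 `^ al)) _.
  apply: ler_wpM2l => //; rewrite -powRM//; apply: ge0_ler_powR; rewrite ?nnegrE ?(ltW al0)//.
  by rewrite /weight -natrM ler_nat; lia.
by rewrite mulrA ler_wpM2r ?powR_ge0.
Qed.

Lemma liminfZ_ge (f : int -> R) (d : R) : (forall x, x != 0 -> d <= f x) -> (d%:E <= liminfZ f)%E.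
Proof.
move=> df; apply: (@le_trans _ _ (ereal_inf ((EFin \o f) @` (~` [set 0])))).
  by apply: le_ereal_inf_tmp => _ [x /eqP x0 <-]; rewrite lee_fin df.
apply: ereal_sup_ubound; exists (~` [set 0]) => //.
by rewrite /frechet_filter/= setCK; exact: finite_set1.
Qed.

Lemma cutoff_rate_cvg0 : (1 + ln n%:R) / ln n%:R ^+ 2 @[n --> \oo] --> (0 : R).
Proof.
apply/cvgr0Pnorm_le => e e0; near=> n.
have l1 : 1 <= ln (n%:R : R) by near: n; exact: ln_dvg.
have l2 : 2 / e <= ln (n%:R : R) by near: n; exact: ln_dvg.
move: (ln _) l1 l2 => l l1 l2; have l0 := lt_le_trans ltr01 l1.
rewrite ger0_norm ?divr_ge0 ?sqr_ge0 ?addr_ge0 ?(ltW l0)// ler_pdivrMr ?exprn_gt0//.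
move: l2; rewrite ler_pdivrMr// => l2.
apply: (@le_trans _ _ (2 * l)); first by lra.
by rewrite expr2 mulrA ler_pM2r// mulrC.
Unshelve. all: by end_near. Qed.

End Asymptotics.

(** * Harmonic functions and supersolutions *)
Section FractionalLaplacian.
Context {R : realType}.
Variable sigma : R.
Hypotheses (sigma_gt0 : 0 < sigma) (sigma_lt_half : sigma < 1 / 2).
Implicit Types (f : int -> R) (x y : int) (N : nat).

Let sigma01 : 0 < sigma < 1. Proof. by apply/andP; split=> //; move: sigma_lt_half; lra. Qed.

Local Notation b := (bsigma sigma).

Lemma bsigma_xx x : b x x = 0.
Proof. by rewrite /bsigma eqxx. Qed.

Lemma bsigma_gt0 x y : x != y -> 0 < b x y.
Proof.
have [c [C [c0 C0 H]]] := bsigma_bounds sigma01 => xy.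
have /andP[+ _] := H x y xy; apply: lt_le_trans.
by rewrite mulr_gt0// powR_gt0// ltr0n absz_gt0 subr_eq0.
Qed.

Lemma bsigma_ge0 x y : 0 <= b x y.
Proof. by have [->|/bsigma_gt0/ltW//] := eqVneq x y; rewrite bsigma_xx. Qed.

Lemma bsigma_row_bounded : exists M, forall x N, \sum_(k < N) b x (enumZ k) <= M.
Proof.
have [c [C [c0 C0 H]]] := bsigma_bounds sigma01.
exists (C * (2 * ((1 + (2 * sigma)^-1) * 1%:R `^ (- (2 * sigma))))) => x N.
have s0 : 0 < 2 * sigma by rewrite mulr_gt0.
have s1 : 2 * sigma <= 1 by move: sigma_lt_half; lra.
have row := @series_enumZ_le R x (truncated_tail (2 * sigma) 1) _ N
    (truncated_tail_ge0 _ _) (fun K => @sum_truncated_tail R (2 * sigma) 1 K s0 s1 isT).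
apply: le_trans (ler_wpM2l (ltW C0) row); rewrite mulr_sumr; apply: ler_sum => k _.
have [->|xy] := eqVneq x (enumZ k).
  by rewrite bsigma_xx mulr_ge0 ?(ltW C0)// truncated_tail_ge0.
have /andP[_] := H _ _ xy; rewrite /truncated_tail.
have k0 : (0 < `|x - enumZ k|)%N by rewrite absz_gt0 subr_eq0.
rewrite ifF ?gtn_eqF// divr1 min_l ?mulr1//.
by rewrite exprn_ege1// ler1n.
Qed.

Definition degree x : R := limn (series (fun k => b x (enumZ k))).

Lemma is_cvg_degree x : cvgn (series (fun k => b x (enumZ k))).
Proof.
have [M HM] := bsigma_row_bounded; apply: nondecreasing_is_cvgn.
  by apply: series_nneg_nondecreasing => k; exact: bsigma_ge0.
by exists M => _ [N _ <-]; rewrite series_ord.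
Qed.

Lemma degree_bounded : exists M, 0 <= M /\ forall x, degree x <= M.
Proof.
have [M HM] := bsigma_row_bounded; exists M; split; first by rewrite (le_trans _ (HM 0 0%N))// big_ord0.
move=> x; apply: limr_le; first exact: is_cvg_degree.
by apply: nearW => N; rewrite series_ord.
Qed.

Lemma Fsigma_cvg f x : Fsigma sigma f -> cvgn (series (fun k => b x (enumZ k) * `|f (enumZ k)|)).
Proof.
move=> /(_ x); have f0 y : 0 <= b x y * `|f y| by rewrite mulr_ge0 ?bsigma_ge0.
exact: (esum_ltyP f0).1.
Qed.

(** The fractional Laplacian splits into its diagonal and its jump part. *)
Lemma jump_sum_cvg f x : Fsigma sigma f ->
  series (fun k => b x (enumZ k) * f (enumZ k)) @ \oo --> degree x * f x - fracLaplacian sigma f x.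
Proof.
move=> Ff; have cf := @Fsigma_cvg f x Ff; have cd := @is_cvg_degree x.
have cabs : cvgn (series (fun k => `|b x (enumZ k) * (f x - f (enumZ k))|)).
  apply: (@series_le_cvg _ _ (fun k => `|f x| * b x (enumZ k) + b x (enumZ k) * `|f (enumZ k)|)) => //.
  - by move=> k; rewrite addr_ge0// mulr_ge0 ?bsigma_ge0.
  - move=> k; rewrite normrM (ger0_norm (bsigma_ge0 _ _)) [`|f x| * _]mulrC -mulrDr.
    by rewrite ler_wpM2l ?bsigma_ge0// ler_normB.
  - rewrite (_ : series _ = (fun N => `|f x| * series (fun k => b x (enumZ k)) N
       + series (fun k => b x (enumZ k) * `|f (enumZ k)|) N)).
      by apply: is_cvgD => //; apply: is_cvgM => //; exact: is_cvg_cst.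
    by apply/funext => N; rewrite !series_ord mulr_sumr -big_split.
have L := @sumZ_cvg R (fun y => b x y * (f x - f y)) cabs.
rewrite (_ : series _ = (fun N => series (fun k => b x (enumZ k)) N * f x -
   series ((fun y => b x y * (f x - f y)) \o enumZ) N)).
  by apply: cvgB => //; apply: cvgM => //; exact: cvg_cst.
apply/funext => N; rewrite !series_ord mulr_suml -sumrB; apply: eq_bigr => k _ /=.
by rewrite mulrBr subKr.
Qed.

Section Potential.
Variable V : int -> R.

Lemma harmonic_cvg u x : schrodinger_harmonic sigma V u ->
  series (fun k => b x (enumZ k) * u (enumZ k)) @ \oo --> (degree x + V x) * u x.
Proof.
move=> [Fu /(_ x) Hu]; have := @jump_sum_cvg u x Fu.
by rewrite (_ : _ - _ = (degree x + V x) * u x)//; move: Hu; rewrite /schrodinger; lra.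
Qed.

Lemma supersolution_sum_le w x N : Fsigma sigma w -> (forall x, 0 <= w x) ->
  (forall x, 0 <= schrodinger sigma V w x) ->
  \sum_(k < N) b x (enumZ k) * w (enumZ k) <= (degree x + V x) * w x.
Proof.
move=> Fw w0 Hw; have L := @jump_sum_cvg w x Fw.
apply: (@le_trans _ _ (degree x * w x - fracLaplacian sigma w x)).
  rewrite -(cvg_lim _ L)// -(series_ord (fun k => b x (enumZ k) * w (enumZ k))).
  apply: nondecreasing_cvgn_le; last by apply/cvg_ex; eexists; exact: L.
  by apply: series_nneg_nondecreasing => k; rewrite mulr_ge0 ?bsigma_ge0.
by have := Hw x; rewrite /schrodinger; lra.
Qed.

Lemma supersolution_le w x y : Fsigma sigma w -> (forall x, 0 <= w x) ->
  (forall x, 0 <= schrodinger sigma V w x) -> b x y * w y <= (degree x + V x) * w x.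
Proof.
move=> Fw w0 Hw; have [g _ gK] := enumZ_bij.
apply: le_trans (@supersolution_sum_le w x (g y).+1 Fw w0 Hw).
rewrite big_ord_recr/= gK lerDr sumr_ge0// => k _.
by rewrite mulr_ge0 ?bsigma_ge0.
Qed.

(** Minimum principle: at a zero of [w] the inequality retains only the jump
    terms, all of one sign, and a jump reaches every other point. *)
Lemma supersolution_gt0 w : Fsigma sigma w -> (exists x, w x != 0) -> (forall x, 0 <= w x) ->
  (forall x, 0 <= schrodinger sigma V w x) -> forall x, 0 < w x.
Proof.
move=> Fw [y wy] w0 Hw x; rewrite lt_neqAle w0 andbT eq_sym; apply/eqP => wx.
have [xy|xy] := eqVneq x y; first by rewrite -xy wx eqxx in wy.
have := @supersolution_le w x y Fw w0 Hw; rewrite wx mulr0 leNgt mulr_gt0 ?bsigma_gt0//.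
by rewrite lt_neqAle w0 eq_sym wy.
Qed.

End Potential.

Section Comparison.
Variables (V u w : int -> R).
Hypotheses (u_harm : schrodinger_harmonic sigma V u) (Fw : Fsigma sigma w).
Hypotheses (w_gt0 : forall x, 0 < w x) (w_super : forall x, 0 <= schrodinger sigma V w x).
Variable C : R.
Hypothesis u_le : forall x, `|u x| <= C * weight x `^ (- ((1 - 2 * sigma) / 2)).

(** The defect of harmonicity of [u] on a finite window, tested against the
    cutoff. *)
Let defect n N := \sum_(i < N) cutoff n (enumZ i) ^+ 2 * u (enumZ i) *
  ((degree (enumZ i) + V (enumZ i)) * u (enumZ i)
   - \sum_(j < N) b (enumZ i) (enumZ j) * u (enumZ j)).

(** The support of the cutoff is a fixed finite set, and at each of its points
    the defect vanishes in the limit. *)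
Let defect_cvg0 n : (2 <= n)%N -> defect n N @[N --> \oo] --> 0.
Proof.
move=> n2; pose G i N := cutoff n (enumZ i) ^+ 2 * u (enumZ i) *
  ((degree (enumZ i) + V (enumZ i)) * u (enumZ i)
   - \sum_(j < N) b (enumZ i) (enumZ j) * u (enumZ j)).
have G0 i : G i N @[N --> \oo] --> 0.
  rewrite -(mulr0 (cutoff n (enumZ i) ^+ 2 * u (enumZ i))) /G; apply: cvgM; first exact: cvg_cst.
  rewrite -[X in _ --> X](subrr ((degree (enumZ i) + V (enumZ i)) * u (enumZ i))).
  apply: cvgB; first exact: cvg_cst.
  have := @harmonic_cvg V u (enumZ i) u_harm.
  rewrite (_ : series _ = (fun N => \sum_(j < N) b (enumZ i) (enumZ j) * u (enumZ j)))//.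
  by apply/funext => N; exact: series_ord.
have S0 : \sum_(i < n.*2) G i N @[N --> \oo] --> 0.
  rewrite [X in _ --> X](_ : 0 = \sum_(i < n.*2) 0); last by rewrite big1.
  apply: (cvg_big _ (Ff := fun (i : 'I_n.*2) N => G i N)) => [|i _]; last exact: G0.
  by move=> [x y]; exact: add_continuous.
apply: cvg_trans S0; apply: near_eq_cvg; near=> N.
have nN : (n.*2 <= N)%N by near: N; exact: nbhs_infty_ge.
rewrite /defect -!(big_mkord xpredT (fun i => G i N)) (@big_cat_nat _ _ _ n.*2 0 N)//=.
rewrite [X in _ = _ + X]big_nat_cond [X in _ = _ + X]big1 ?addr0// => i /andP[/andP[ni _] _].
by rewrite /G cutoff_eq0 ?enumZ_far// expr0n/= !mul0r.
Unshelve. all: by end_near. Qed.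

Let term n x y := b x y * (w x * w y * (u x * cutoff n x / w x - u y * cutoff n y / w y) ^+ 2).

(** Each single pair is controlled by the whole energy with respect to [w]; the
    window then grows while the cutoff is kept fixed. *)
Let term_le : exists K, forall n x y, (2 <= n)%N -> term n x y <= K * ((1 + ln n%:R) / ln n%:R ^+ 2).
Proof.
have [c [CB [c0 CB0 HB]]] := bsigma_bounds sigma01.
have [K HK] := @cutoff_energy_le R sigma b CB sigma_gt0 sigma_lt_half (ltW CB0) bsigma_xx
  (fun x y xy => (andP (HB x y xy)).2) bsigma_ge0 (bsigma_sym sigma01).
exists (C ^+ 2 * K) => n x y n2; have [g _ gK] := enumZ_bij.
have le N : (g x < N)%N -> (g y < N)%N ->
    term n x y <= C ^+ 2 * K * ((1 + ln n%:R) / ln n%:R ^+ 2) + 2 * defect n N.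
  move=> xN yN.
  have term_ge0 z t : 0 <= term n z t.
    by apply: mulr_ge0; rewrite ?bsigma_ge0// mulr_ge0 ?sqr_ge0// mulr_ge0// ltW.
  have := @energy_comparison R N (fun i j => b (enumZ i) (enumZ j)) (u \o enumZ) (w \o enumZ)
    (fun i => cutoff n (enumZ i)) (fun i => degree (enumZ i) + V (enumZ i))
    (fun i j => bsigma_sym sigma01 _ _) (fun i => w_gt0 _)
    (fun i => @supersolution_sum_le V w (enumZ i) N Fw (fun z => ltW (w_gt0 z)) w_super).
  rewrite -/(defect n N) => H.
  have lo : term n x y <= \sum_(i < N) \sum_(j < N) term n (enumZ i) (enumZ j).
    rewrite (bigD1 (Ordinal xN))//= gK (bigD1 (Ordinal yN))//= gK -addrA lerDl.
    by rewrite addr_ge0// ?sumr_ge0// => i _; rewrite sumr_ge0.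
  apply: le_trans lo _; apply: le_trans H _; rewrite lerD2r.
  have := ler_wpM2l (sqr_ge0 C) (HK n N n2); rewrite [X in _ <= X]mulrA; apply: le_trans.
  rewrite mulr_sumr; apply: ler_sum => i _; rewrite mulr_sumr; apply: ler_sum => j _.
  rewrite [leRHS]mulrCA; apply: ler_wpM2l; first exact: bsigma_ge0.
  rewrite [leRHS]mulrA; apply: ler_wpM2r; first exact: sqr_ge0.
  apply: le_trans (ler_norm _) _; rewrite normrM /=.
  apply: le_trans (ler_pM _ _ (u_le _) (u_le _)) _ => //.
  by rewrite expr2 mulrACA.
have D0 : C ^+ 2 * K * ((1 + ln n%:R) / ln n%:R ^+ 2) + 2 * defect n N @[N --> \oo]
    --> C ^+ 2 * K * ((1 + ln n%:R) / ln n%:R ^+ 2).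
  rewrite -[X in _ --> X]addr0; apply: cvgD; first exact: cvg_cst.
  by rewrite -(mulr0 2); apply: cvgM; [exact: cvg_cst | exact: defect_cvg0].
rewrite -(cvg_lim _ D0)//; apply: limr_ge; first by apply/cvg_ex; eexists; exact: D0.
near=> N; apply: le; near: N; exact: nbhs_infty_gt.
Unshelve. all: by end_near. Qed.

(** The energy of the cutoffs tends to [0] while the cutoffs tend to [1]. *)
Lemma harmonic_proportional x y : u x / w x = u y / w y.
Proof.
have [->//|xy] := eqVneq x y.
have [K HK] := term_le.
have L : term n x y @[n --> \oo] --> b x y * (w x * w y * (u x * 1 / w x - u y * 1 / w y) ^+ 2).
  apply: cvgM; first exact: cvg_cst.
  apply: cvgM; first exact: cvg_cst.
  have E z : u z * cutoff n z / w z @[n --> \oo] --> u z * 1 / w z.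
    by apply: cvgM; [apply: cvgM; [exact: cvg_cst | exact: cutoff_cvg] | exact: cvg_cst].
  by rewrite expr2; under eq_fun do rewrite expr2; apply: cvgM; apply: cvgB; exact: E.
have L0 : K * ((1 + ln n%:R) / ln n%:R ^+ 2) @[n --> \oo] --> K * (0 : R).
  by apply: cvgM; [exact: cvg_cst | exact: cutoff_rate_cvg0].
have : b x y * (w x * w y * (u x * 1 / w x - u y * 1 / w y) ^+ 2) <= 0.
  rewrite -(cvg_lim _ L)// -(mulr0 K) -(cvg_lim _ L0)//; apply: ler_lim.
  - by apply/cvg_ex; eexists; exact: L.
  - by apply/cvg_ex; eexists; exact: L0.
  - by near=> n; apply: HK; near: n; exact: nbhs_infty_ge.
rewrite !mulr1 pmulr_rle0 ?bsigma_gt0// pmulr_rle0 ?mulr_gt0// => sq.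
have : (u x / w x - u y / w y) ^+ 2 == 0 by rewrite eq_le sq sqr_ge0.
by rewrite sqrf_eq0 subr_eq0 => /eqP.
Unshelve. all: by end_near. Qed.

End Comparison.

(** A supersolution at [x] dominates the single jump from [x] to the origin. *)
Lemma supersolution_lower_bound V w : (forall x, V x <= 1) -> Fsigma sigma w ->
  (forall x, 0 < w x) -> (forall x, 0 <= schrodinger sigma V w x) ->
  exists2 d, 0 < d & forall x, x != 0 -> d <= w x * absZ R x `^ (1 + 2 * sigma).
Proof.
move=> V1 Fw w0 Hw.
have [c [C [c0 C0 HB]]] := bsigma_bounds sigma01.
have [M [M0 HM]] := degree_bounded.
have M1 : 0 < M + 1 by rewrite ltr_wpDl.
exists (c * w 0 / (M + 1)) => [|x x0]; first by rewrite divr_gt0// mulr_gt0.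
have axE : absZ R x = `|x|%N%:R by rewrite /absZ natr_absz intr_norm.
have ax0 : (0 : R) < `|x|%N%:R by rewrite ltr0n absz_gt0.
rewrite ler_pdivrMr// axE mulrAC -ler_pdivrMr ?powR_gt0// -powRN mulrAC.
have /andP[+ _] := HB x 0 x0; rewrite subr0 => h.
apply: le_trans (ler_wpM2r (ltW (w0 0)) h) _.
apply: le_trans (@supersolution_le V w x 0 Fw (fun z => ltW (w0 z)) Hw) _.
by rewrite mulrC ler_wpM2l ?(ltW (w0 x))// lerD.
Qed.

End FractionalLaplacian.

Unset Implicit Arguments.

Theorem theorem5p2 (R : realType) (sigma : R) (V u : int -> R)
    (sigma_gt0 : 0 < sigma) (sigma_lt_half : sigma < 1 / 2)
    (H_pos : positive_schrodinger sigma V)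
    (V_le1 : forall x : int, V x <= 1)
    (u_harm : schrodinger_harmonic sigma V u)
    (u_bigO : bigO_Z u (fun x : int => absZ R x `^ ((2 * sigma - 1) / 2)))
    (u_liminf :
       liminfZ (fun x : int => `|u x| * absZ R x `^ (1 + 2 * sigma)) = 0%E) :
  forall x : int, u x = 0.
Proof.
have [w [Fw w_neq0 w_ge0 w_super]] := H_pos.
have w_gt0 := supersolution_gt0 sigma_gt0 sigma_lt_half Fw w_neq0 w_ge0 w_super.
have [C u_le] : exists C, forall x, `|u x| <= C * weight x `^ (- ((1 - 2 * sigma) / 2)).
  have al_gt0 : 0 < (1 - 2 * sigma) / 2 by lra.
  have alE : (2 * sigma - 1) / 2 = - ((1 - 2 * sigma) / 2) by field.
  rewrite alE in u_bigO; exact: bigO_weight al_gt0 u_bigO.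
have prop x := harmonic_proportional sigma_gt0 sigma_lt_half u_harm Fw w_gt0 w_super u_le x 0.
have uE x : u x = u 0 / w 0 * w x by rewrite -(prop x) divfK// gt_eqF ?w_gt0.
have [k0|k_neq0] := eqVneq (u 0 / w 0) 0; first by move=> x; rewrite uE k0 mul0r.
have [d d_gt0 Hd] := supersolution_lower_bound sigma_gt0 sigma_lt_half V_le1 Fw w_gt0 w_super.
have k_gt0 : 0 < `|u 0 / w 0| by rewrite normr_gt0.
have : ((`|u 0 / w 0| * d)%:E <= 0 :> \bar R)%E.
  rewrite -u_liminf; apply: liminfZ_ge => x x0.
  by rewrite (uE x) (normrM _ (w x)) (gtr0_norm (w_gt0 x)) -mulrA ler_wpM2l ?Hd// ltW.
by rewrite lee_fin leNgt mulr_gt0.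
Qed.
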